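(* Let $G$ be a simply connected five dimensional nilpotent Lie group with a left invariant Riemannian metric $\tilde a$, whose Lie algebra $\mathfrak l_{5,6}$ has an $\tilde a$-orthonormal basis $\{E_1,\dots,E_5\}$ with non-zero brackets $[E_1,E_2]=aE_3+bE_4+cE_5$, $[E_1,E_3]=dE_4+fE_5$, $[E_1,E_4]=gE_5$, $[E_2,E_3]=hE_5$, where $a,d,g,h>0$ and either $b>0$, or $b=0$ and $f\ge0$. Let $F(x,y)=\sqrt{\tilde a(y,y)}+\tilde a(X(x),y)$ be a Randers metric of Douglas type on $G$, where $X$ is a left invariant vector field with $\sqrt{\tilde a(X,X)}<1$. Then a non-zero vector $Y=y_1E_1+y_2E_2+y_3E_3+y_4E_4+y_5E_5$ is a geodesic vector of $(G,F)$ if and only if one of the following holds: $Y\in\operatorname{span}\{E_1,E_2\}$; or $Y\in\operatorname{span}\{E_2,E_3,E_4\}$ and $ay_2y_3+by_2y_4+dy_3y_4=0$; or $Y\in\operatorname{span}\{E_5\}$.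
   Context: Brackets of basis elements not listed (and not obtained by antisymmetry) are zero. The spray coefficients of $F$ in standard local coordinates $(x,y)$ of the tangent bundle are $G^i=\frac14 g^{il}\big([F^2]_{x^my^l}y^m-[F^2]_{x^l}\big)$, where $g_{ij}=\frac12\frac{\partial^2F^2}{\partial y^i\partial y^j}$. $F$ is of Douglas type if in every standard local coordinate system $G^i=\frac12\Gamma^i_{jk}(x)y^jy^k+P(x,y)y^i$ for some functions $\Gamma^i_{jk}(x)$ and some local function $P(x,y)$ positively homogeneous of degree one in $y$. A non-zero vector $Y$ of the Lie algebra is a geodesic vector of $(G,F)$ if the curve $t\mapsto\exp(tY)$ is a geodesic of $(G,F)$. *)

(* Defs.v *)
From HB Require Import structures.
From mathcomp Require Import all_boot all_order all_algebra.
From mathcomp Require Import all_classical all_reals all_analysis.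

Set Implicit Arguments.
Unset Strict Implicit.
Unset Printing Implicit Defensive.

Import Order.TTheory GRing.Theory Num.Theory.
Import numFieldNormedType.Exports.

Local Open Scope classical_set_scope.
Local Open Scope ring_scope.

(* [f] is of class C^k on the open set [U]; in finite dimension, the          *)
(* differential of [f] is C^k iff all the directional derivatives of [f] are. *)
Fixpoint Ck_on (R : realType) (V W : normedModType R) (k : nat) (U : set V)
    (f : V -> W) : Prop :=
  if k is k'.+1 then
    (forall x, U x -> differentiable f x) /\
    (forall v, Ck_on k' U (fun x => 'D_v f x))
  else forall x, U x -> {for x, continuous f}.

Definition smooth_on (R : realType) (V W : normedModType R) (U : set V)
    (f : V -> W) : Prop := forall k, Ck_on k U f.

(* The values of [coord] outside [dom] and of [pt] outside [cod] are          *)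
(* irrelevant.                                                                *)
Record chart (R : realType) (n : nat) (M : topologicalType) := Chart {
  dom : set M;
  cod : set 'rV[R]_n;
  coord : M -> 'rV[R]_n;
  pt : 'rV[R]_n -> M;
  open_dom : open dom;
  open_cod : open cod;
  coord_cod : forall p, dom p -> cod (coord p);
  pt_dom : forall x, cod x -> dom (pt x);
  coordK : forall p, dom p -> pt (coord p) = p;
  ptK : forall x, cod x -> coord (pt x) = x;
  coord_continuous : forall p, dom p -> {for p, continuous coord};
  pt_continuous : forall x, cod x -> {for x, continuous pt} }.

Section Charts.
Context {R : realType} {n : nat} {M : topologicalType}.
Implicit Types c d : chart R n M.

Definition overlap c d : set 'rV[R]_n :=
  [set x | cod c x /\ dom d (pt c x)].

Definition transition c d : 'rV[R]_n -> 'rV[R]_n := fun x => coord d (pt c x).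

Definition compatible c d : Prop :=
  smooth_on (overlap c d) (transition c d) /\
  smooth_on (overlap d c) (transition d c).

Definition maximal_atlas (A : set (chart R n M)) : Prop :=
  [/\ forall p, exists2 c, A c & dom c p,
      forall c d, A c -> A d -> compatible c d &
      forall c, (forall d, A d -> compatible c d) -> A c].

End Charts.

#[short(type="topGroupType")]
HB.structure Definition TopGroup := {G of Topological G & Group G}.

Record lieGroup (R : realType) (n : nat) := LieGroup {
  lie_sort :> topGroupType;
  atlas : set (chart R n lie_sort);
  lie_hausdorff : hausdorff_space lie_sort;
  lie_second_countable : @second_countable lie_sort;
  atlas_maximal : maximal_atlas atlas;
  mul_continuous : continuous (fun p : lie_sort * lie_sort => (p.1 * p.2)%g);
  inv_continuous : continuous (fun p : lie_sort => (p^-1)%g);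
  mul_smooth : forall c1 c2 d, atlas c1 -> atlas c2 -> atlas d ->
    smooth_on
      [set z : 'rV[R]_n * 'rV[R]_n |
        [/\ cod c1 z.1, cod c2 z.2 & dom d (pt c1 z.1 * pt c2 z.2)%g]]
      (fun z => coord d (pt c1 z.1 * pt c2 z.2)%g);
  inv_smooth : forall c d, atlas c -> atlas d ->
    smooth_on [set x | cod c x /\ dom d ((pt c x)^-1)%g]
      (fun x => coord d ((pt c x)^-1)%g) }.

Definition simply_connected (R : realType) (T : topologicalType) : Prop :=
  [/\ exists p : T, True,
      forall p q : T, exists c : R -> T,
        [/\ {within `[0, 1], continuous c}, c 0 = p & c 1 = q] &
      forall (p : T) (c : R -> T),
        {within `[0, 1], continuous c} -> c 0 = p -> c 1 = p ->
        exists H : R * R -> T,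
          [/\ {within `[0, 1] `*` `[0, 1], continuous H},
              forall t, t \in `[0, 1] -> H (0, t) = c t,
              forall t, t \in `[0, 1] -> H (1, t) = p &
              forall s, s \in `[0, 1] -> H (s, 0) = p /\ H (s, 1) = p]].

Inductive lower_central (G : groupType) : nat -> G -> Prop :=
| lower_central_top x : lower_central 0 x
| lower_central_comm k x y : lower_central k x ->
    lower_central k.+1 [~ x, y]%g
| lower_central_one k : lower_central k.+1 1%g
| lower_central_mul k x y : lower_central k.+1 x -> lower_central k.+1 y ->
    lower_central k.+1 (x * y)%g
| lower_central_inv k x : lower_central k.+1 x ->
    lower_central k.+1 (x^-1)%g.

Definition nilpotent_group (G : groupType) : Prop :=
  exists k, forall x : G, lower_central k x -> x = 1%g.

Section Geometry.
Context {R : realType} {n : nat} (G : lieGroup R n).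

Definition ltranslation (g : G) (c d : chart R n G) : 'rV[R]_n -> 'rV[R]_n :=
  fun x => coord d (g * pt c x)%g.

Definition ltranslation_dom (g : G) (c d : chart R n G) : set 'rV[R]_n :=
  [set x | cod c x /\ dom d (g * pt c x)%g].

(* A vector field [X] is given by its components [X c x] in each chart [c] of
   the atlas, at the point of coordinates [x]; they are only meaningful for
   [x] in [cod c], so vector fields are compared with [vf_eq]. *)

Definition vfield : Type := chart R n G -> 'rV[R]_n -> 'rV[R]_n.

Implicit Types X Y : vfield.

Definition vf_eq X Y : Prop :=
  forall c, atlas c -> forall x, cod c x -> X c x = Y c x.

Definition smooth_vfield X : Prop :=
  (forall c, atlas c -> smooth_on (cod c) (X c)) /\
  (forall c d, atlas c -> atlas d -> forall x, overlap c d x ->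
     X d (transition c d x) = 'D_(X c x) (transition c d) x).

Definition left_invariant X : Prop :=
  smooth_vfield X /\
  (forall g c d, atlas c -> atlas d -> forall x, ltranslation_dom g c d x ->
     X d (ltranslation g c d x) = 'D_(X c x) (ltranslation g c d) x).

Definition lie_bracket X Y : vfield :=
  fun c x => 'D_(X c x) (Y c) x - 'D_(Y c x) (X c) x.

Definition vf_span (Es : seq vfield) X : Prop :=
  exists s : nat -> R, vf_eq X (\sum_(i < size Es) s i *: Es`_i).

Definition inner (A : 'M[R]_n) (u v : 'rV[R]_n) : R := (u *m A *m v^T) 0 0.

(* [a c x] is the matrix (a_ij(x)) of a 2-tensor [a] in the chart [c].        *)
Definition tensor2 : Type := chart R n G -> 'rV[R]_n -> 'M[R]_n.

Definition riemannian_metric (a : tensor2) : Prop :=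
  [/\ forall c, atlas c -> smooth_on (cod c) (a c),
      forall c, atlas c -> forall x, cod c x -> (a c x)^T = a c x,
      forall c, atlas c -> forall x, cod c x ->
        forall u, u != 0 -> 0 < inner (a c x) u u &
      forall c d, atlas c -> atlas d -> forall x, overlap c d x ->
        forall u v, inner (a c x) u v =
          inner (a d (transition c d x))
            ('D_u (transition c d) x) ('D_v (transition c d) x)].

Definition left_invariant_metric (a : tensor2) : Prop :=
  riemannian_metric a /\
  (forall g c d, atlas c -> atlas d -> forall x, ltranslation_dom g c d x ->
     forall u v, inner (a c x) u v =
       inner (a d (ltranslation g c d x))
         ('D_u (ltranslation g c d) x) ('D_v (ltranslation g c d) x)).

Definition orthonormal_basis (a : tensor2) m (Es : m.-tuple vfield) : Prop :=
  [/\ forall i, left_invariant (tnth Es i),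
      forall X, left_invariant X -> vf_span Es X &
      forall c, atlas c -> forall x, cod c x -> forall i j,
        inner (a c x) (tnth Es i c x) (tnth Es j c x) = (i == j)%:R].

(* [F c x y] is the value of the metric at the tangent vector of components
   [y], at the point of coordinates [x] in the chart [c]. *)

Definition finsler : Type := chart R n G -> 'rV[R]_n -> 'rV[R]_n -> R.

Definition randers (a : tensor2) X : finsler :=
  fun c x y => Num.sqrt (inner (a c x) y y) + inner (a c x) (X c x) y.

Implicit Type F : finsler.

Definition basis_vec (i : 'I_n) : 'rV[R]_n := delta_mx 0 i.

Definition fundamental_tensor F : chart R n G -> 'rV[R]_n -> 'rV[R]_n ->
    'M[R]_n :=
  fun c x y => \matrix_(i, j)
    (2^-1 * 'D_(basis_vec i) (fun v => 'D_(basis_vec j)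
                                (fun w => F c x w ^+ 2) v) y).

Definition spray F (c : chart R n G) (x y : 'rV[R]_n) : 'rV[R]_n :=
  \row_i (4^-1 * \sum_l invmx (fundamental_tensor F c x y) i l *
    (\sum_m 'D_(basis_vec l) (fun v => 'D_(basis_vec m)
                                (fun z => F c z v ^+ 2) x) y * y 0 m
     - 'D_(basis_vec l) (fun z => F c z y ^+ 2) x)).

Definition douglas F : Prop :=
  forall c, atlas c ->
  exists (Gamma : 'I_n -> 'I_n -> 'I_n -> 'rV[R]_n -> R)
         (P : 'rV[R]_n -> 'rV[R]_n -> R),
    (forall x y (t : R), cod c x -> y != 0 -> 0 < t ->
       P x (t *: y) = t * P x y) /\
    (forall x y, cod c x -> y != 0 -> forall i,
       spray F c x y 0 i =
       2^-1 * (\sum_j \sum_k Gamma i j k x * y 0 j * y 0 k) + P x y * y 0 i).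

Definition smooth_curve (gam : R -> G) : Prop :=
  continuous gam /\
  (forall c, atlas c -> smooth_on (gam @^-1` dom c) (coord c \o gam)).

Definition geodesic F (gam : R -> G) : Prop :=
  smooth_curve gam /\
  (forall c, atlas c -> forall t, dom c (gam t) ->
     let x := coord c \o gam in
     derive1n 2 x t + 2 *: spray F c (x t) (derive1 x t) = 0).

(* [gam] is the curve t |-> exp(tY), the one-parameter subgroup of [G] with   *)
(* initial velocity [Y] at the identity.                                      *)
Definition exp_curve Y (gam : R -> G) : Prop :=
  [/\ smooth_curve gam,
      forall s t, gam (s + t) = (gam s * gam t)%g &
      forall c, atlas c -> dom c 1%g ->
        derive1 (coord c \o gam) 0 = Y c (coord c 1%g)].

Definition geodesic_vector F Y : Prop :=
  exists2 gam, exp_curve Y gam & geodesic F gam.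

Definition l56_brackets (E1 E2 E3 E4 E5 : vfield) (a b c d f g h : R) : Prop :=
  vf_eq (lie_bracket E1 E2) (a *: E3 + b *: E4 + c *: E5) /\
  vf_eq (lie_bracket E1 E3) (d *: E4 + f *: E5) /\
  vf_eq (lie_bracket E1 E4) (g *: E5) /\
  vf_eq (lie_bracket E1 E5) 0 /\
  vf_eq (lie_bracket E2 E3) (h *: E5) /\
  vf_eq (lie_bracket E2 E4) 0 /\
  vf_eq (lie_bracket E2 E5) 0 /\
  vf_eq (lie_bracket E3 E4) 0 /\
  vf_eq (lie_bracket E3 E5) 0 /\
  vf_eq (lie_bracket E4 E5) 0.

End Geometry.

(* Main.v *)
Require Import Defs.
From HB Require Import structures.
From mathcomp Require Import all_boot all_order all_algebra.
From mathcomp Require Import all_classical all_reals all_analysis.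
From mathcomp Require Import ring lra.
Set Implicit Arguments.
Unset Strict Implicit.
Unset Printing Implicit Defensive.
Import Order.TTheory GRing.Theory Num.Theory.
Import numFieldNormedType.Exports.
Local Open Scope classical_set_scope.
Local Open Scope ring_scope.
(* [coord] and [coord_continuous] denote those of charts from here on. *)
Import Defs.

(** Write [F = alpha + beta], with [alpha] the norm of the left invariant metric
    and [beta] the one-form dual to [X].  The idea is that the Douglas condition
    forces [beta] to be closed, and that [F] then has the geodesics of [alpha]
    up to parametrization, so that being a geodesic vector becomes the
    Riemannian condition [<Y, [Z, Y]> = 0] for all left invariant [Z].

    Two facts about the spray [S] of [F] carry this.  Its defining equation
    pairs [S y] with the fundamental tensor [F_u F_w + F h(u, w)], where [h] is
    the Hessian of [alpha] in the fibre.  As [h(y, .) = 0], contracting with [y]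
    isolates [F_(S y)], and what remains is a formula for [h(S y, w)] whose
    even part in [y] comes from [alpha] and whose odd part is [d beta (y, w)]
    up to a factor ([coordinate_spray_split], [even_odd_spray]).  For a Douglas
    metric [S y - S (- y)] is proportional to [y], the quadratic terms
    cancelling, so the odd part vanishes: [d beta = 0] ([closed_of_parallel],
    [douglas_closed]).

    Along [exp (t Y)] the velocity is [Y] and the acceleration is [D_Y Y].  The
    fundamental tensor is nondegenerate, because [|X| < 1], so the geodesic
    equation can be tested against it.  Its component along [y] says that
    [F (Y)] is constant, which left invariance gives, and its transverse part is
    the Koszul formula, since all products of left invariant fields are constant
    ([geodesic_equationP], [frame_geodesic_form], [geodesic_at]).  For the
    brackets of the theorem the resulting five polynomial equations are solved
    in [l56_geodesic_equations].

    In the other direction the curve [exp (t Y)] has to be produced.  Picard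
    iteration in a chart around the identity gives an integral curve [gam] of
    [Y]; by uniqueness it is a homomorphism for small times
    ([one_parameter_germ]).  It extends to the line as
    [gam (t / 2 ^ N) ^ (2 ^ N)] for large [N] ([local_hom_extension]), and it is
    smooth because differentiating [W (gam t)] replaces the smooth function [W]
    by the smooth function [D_Y W] ([Ck_on_integral_curve]). *)

(** * Directional derivatives *)

Section DirectionalDerivatives.
Context {R : realType}.

Lemma is_derive_mxP {V : normedModType R} m n (f : V -> 'M[R]_(m, n)) x v df :
  is_derive x v f df <->
  forall i j, is_derive x v (fun z => f z i j) (df i j).
Proof.
split=> [[fd <-] i j|H].
  split; first by move/derivable_mxP : fd; apply.
  by rewrite derive_mx// mxE.
have fd : derivable f x v by apply/derivable_mxP => i j; case: (H i j).
split=> //; rewrite derive_mx//; apply/matrixP => i j; rewrite mxE.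
by case: (H i j).
Qed.

Lemma is_derive_mulmx {V : normedModType R} m n p (M : V -> 'M[R]_(m, n))
    (N : V -> 'M[R]_(n, p)) x v dM dN :
  is_derive x v M dM -> is_derive x v N dN ->
  is_derive x v (fun z => M z *m N z) (dM *m N x + M x *m dN).
Proof.
move=> /is_derive_mxP HM /is_derive_mxP HN; apply/is_derive_mxP => i j.
rewrite (_ : (fun z => _) =
  \sum_(k < n) ((fun z => M z i k) * (fun z => N z k j))); last first.
  by apply/funext => z; rewrite mxE fct_sumE.
rewrite (_ : _ i j = \sum_(k < n) (M x i k *: dN k j + N x k j *: dM i k)).
  by apply: is_derive_sum => k; exact: is_deriveM.
rewrite !mxE -big_split; apply: eq_bigr => k _ /=.
by rewrite addrC /GRing.scale/= [N x k j * _]mulrC.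
Qed.

Lemma is_derive_trmx {V : normedModType R} m n (M : V -> 'M[R]_(m, n)) x v dM :
  is_derive x v M dM -> is_derive x v (fun z => (M z)^T) dM^T.
Proof.
move=> /is_derive_mxP H; apply/is_derive_mxP => i j.
by rewrite mxE (_ : (fun z => _) = (fun z => M z j i)) //;
  apply/funext => z; rewrite mxE.
Qed.

Lemma is_derive_inner {V : normedModType R} n (A : V -> 'M[R]_n)
    (u w : V -> 'rV[R]_n) x v dA du dw :
  is_derive x v A dA -> is_derive x v u du -> is_derive x v w dw ->
  is_derive x v (fun z => inner (A z) (u z) (w z))
    (inner dA (u x) (w x) + inner (A x) du (w x) + inner (A x) (u x) dw).
Proof.
move=> HA Hu Hw.
have := is_derive_mulmx (is_derive_mulmx Hu HA) (is_derive_trmx Hw).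
move/is_derive_mxP => /(_ 0 0) H; apply: (is_derive_eq H).
by rewrite /inner mulmxDl !mxE [X in X + _]addrC.
Qed.

Lemma derive_line {V W : normedModType R} (f : V -> W) x v :
  'D_v f x = 'D_1 (fun t : R => f (t *: v + x)) 0.
Proof.
rewrite /derive; set g1 := fun h => h^-1 *: _; set g2 := fun h => h^-1 *: _.
suff -> : g1 = g2 by [].
by apply/funext => h; rewrite /g1 /g2 /= addr0 scale0r add0r [_%:A]mulr1.
Qed.

(** Only the derivative of [f] along [v] is needed, so the chain rule reduces
    to that of functions of one variable on the line through [x]. *)
Lemma is_derive_comp1 {V : normedModType R} (f : V -> R) (g : R -> R)
    x v df dg :
  is_derive x v f df -> is_derive (f x) 1 g dg ->
  is_derive x v (g \o f) (dg * df).
Proof.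
move=> [/derivable1P fd fE] [gd gE].
pose h t := f (t *: v + x).
have h0 : h 0 = f x by rewrite /h scale0r add0r.
have hd : derivable h 0 1 := fd.
have gd' : derivable g (h 0) 1 by rewrite h0; exact: gd.
split.
  apply/derivable1P; change (derivable (g \o h) 0 1).
  by apply/derivable1_diffP; apply: differentiable_comp;
    apply/derivable1_diffP.
rewrite derive_line; change ('D_1 (g \o h) 0 = dg * df).
rewrite -derive1E derive1_comp; [|exact: hd|exact: gd'].
by rewrite !derive1E h0 gE -fE derive_line.
Qed.

Lemma derive_comp {U V W : normedModType R} (f : U -> V) (g : V -> W) x v :
  differentiable f x -> differentiable g (f x) ->
  'D_v (g \o f) x = 'D_('D_v f x) g (f x).
Proof.
move=> fd gd; rewrite deriveE; last exact: differentiable_comp.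
by rewrite (diff_comp fd gd) /= -!deriveE.
Qed.

Lemma deriveDdir {V W : normedModType R} (f : V -> W) x u v :
  differentiable f x -> 'D_(u + v) f x = 'D_u f x + 'D_v f x.
Proof. by move=> fd; rewrite !deriveE// linearD. Qed.

Lemma deriveZdir {V W : normedModType R} (f : V -> W) x (k : R) u :
  differentiable f x -> 'D_(k *: u) f x = k *: 'D_u f x.
Proof. by move=> fd; rewrite !deriveE// linearZ. Qed.

Lemma derive_row {W : normedModType R} n (f : 'rV[R]_n -> W) x u :
  differentiable f x ->
  'D_u f x = \sum_i u 0 i *: 'D_(delta_mx 0 i) f x.
Proof.
move=> fd; rewrite [in LHS](row_sum_delta u) !deriveE// linear_sum.
by apply: eq_bigr => i _; rewrite linearZ deriveE.
Qed.

Lemma derive_cst_on {V W : normedModType R} (U : set V) (f : V -> W) k x v :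
  open U -> (forall z, U z -> f z = k) -> U x -> 'D_v f x = 0.
Proof.
move=> oU fk Ux; rewrite -(derive_cst k x v); apply: near_eq_derive.
by near=> z; apply: fk; near: z; exact: open_nbhs_nbhs.
Unshelve. all: by end_near. Qed.

Lemma derive_eq_on {V W : normedModType R} (U : set V) (f g : V -> W) x v :
  open U -> (forall z, U z -> f z = g z) -> U x -> 'D_v f x = 'D_v g x.
Proof.
move=> oU fg Ux; apply: near_eq_derive.
by near=> z; apply: fg; near: z; exact: open_nbhs_nbhs.
Unshelve. all: by end_near. Qed.

End DirectionalDerivatives.

(** * Inner products *)

Section InnerProducts.
Context {R : realType} {n : nat}.
Implicit Types (A : 'M[R]_n) (u v w : 'rV[R]_n).

Lemma innerDl A u v w : inner A (u + v) w = inner A u w + inner A v w.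
Proof. by rewrite /inner !mulmxDl mxE. Qed.

Lemma innerDr A u v w : inner A u (v + w) = inner A u v + inner A u w.
Proof. by rewrite /inner linearD mulmxDr mxE. Qed.

Lemma innerZl A k u v : inner A (k *: u) v = k * inner A u v.
Proof. by rewrite /inner -!scalemxAl mxE. Qed.

Lemma innerZr A k u v : inner A u (k *: v) = k * inner A u v.
Proof. by rewrite /inner linearZ -scalemxAr mxE. Qed.

Lemma innerNl A u v : inner A (- u) v = - inner A u v.
Proof. by rewrite -scaleN1r innerZl mulN1r. Qed.

Lemma innerNr A u v : inner A u (- v) = - inner A u v.
Proof. by rewrite -scaleN1r innerZr mulN1r. Qed.

Lemma inner0l A v : inner A 0 v = 0.
Proof. by rewrite -(scale0r 0) innerZl mul0r. Qed.

Lemma inner0r A v : inner A v 0 = 0.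
Proof. by rewrite -(scale0r 0) innerZr mul0r. Qed.

Lemma innerDm A B u v : inner (A + B) u v = inner A u v + inner B u v.
Proof. by rewrite /inner mulmxDr mulmxDl mxE. Qed.

Lemma innerZm k A u v : inner (k *: A) u v = k * inner A u v.
Proof. by rewrite /inner -scalemxAr -scalemxAl mxE. Qed.

Lemma innerNm A u v : inner (- A) u v = - inner A u v.
Proof. by rewrite -scaleN1r innerZm mulN1r. Qed.

Lemma inner0m u v : inner (0 : 'M[R]_n) u v = 0.
Proof. by rewrite -(scale0r 0) innerZm mul0r. Qed.

Definition innerE :=
  (innerDl, innerDr, innerZl, innerZr, innerNl, innerNr, inner0l, inner0r,
   innerDm, innerZm, innerNm, inner0m).

Lemma innerC A u v : A^T = A -> inner A u v = inner A v u.
Proof.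
move=> As; rewrite /inner -[LHS](mxE trmx_key (fun i j => _ j i)).
by rewrite -/(trmx _) !trmx_mul trmxK As mulmxA.
Qed.

Lemma linear_row (phi : 'rV[R]_n -> R) w :
  (forall u v, phi (u + v) = phi u + phi v) ->
  (forall k u, phi (k *: u) = k * phi u) ->
  phi w = \sum_i w 0 i * phi (delta_mx 0 i).
Proof.
move=> phiD phiZ; rewrite [in LHS](row_sum_delta w).
have phi0 : phi 0 = 0 by rewrite -(scale0r 0) phiZ mul0r.
rewrite (big_morph phi phiD phi0); apply: eq_bigr => i _; exact: phiZ.
Qed.

(** The fundamental tensor is given by its entries on the standard basis; this
    recovers the bilinear form from them. *)
Lemma inner_matrix (phi : 'rV[R]_n -> 'rV[R]_n -> R) u w :
  (forall u v w, phi (u + v) w = phi u w + phi v w) ->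
  (forall k u w, phi (k *: u) w = k * phi u w) ->
  (forall u v w, phi u (v + w) = phi u v + phi u w) ->
  (forall k u w, phi u (k *: w) = k * phi u w) ->
  inner (\matrix_(i, j) phi (delta_mx 0 i) (delta_mx 0 j)) u w = phi u w.
Proof.
move=> Dl Zl Dr Zr; rewrite [RHS](linear_row (phi := phi u))//.
rewrite /inner mxE; apply: eq_bigr => j _; rewrite !mxE mulrC.
rewrite (linear_row (phi := phi ^~ _)) //; congr (_ * _).
by apply: eq_bigr => i _; rewrite !mxE.
Qed.

Definition posdef A : Prop := forall u, u != 0 -> 0 < inner A u u.

Lemma inner_ge0 A u : posdef A -> 0 <= inner A u u.
Proof.
move=> Ap; have [->|u0] := eqVneq u 0; first by rewrite innerE.
exact/ltW/Ap.
Qed.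

Lemma inner_nondegenerate A u :
  posdef A -> (forall w, inner A u w = 0) -> u = 0.
Proof.
move=> Ap uw; apply/eqP; apply: contraT => /Ap.
by rewrite uw ltxx.
Qed.

Lemma cauchy_schwarz_inner A u v : A^T = A -> posdef A ->
  inner A u v ^+ 2 <= inner A u u * inner A v v.
Proof.
move=> As Ap; have [->|v0] := eqVneq v 0.
  by rewrite !innerE expr0n mulr0.
have v_gt0 := Ap v v0.
(* A multiple of the component of [u] orthogonal to [v]. *)
have := inner_ge0 (inner A v v *: u - inner A u v *: v) Ap.
rewrite !innerE [inner A v u](innerC _ _ As).
set uu := inner A u u; set vv := inner A v v; set uv := inner A u v.
rewrite (_ : _ + _ = vv * (uu * vv - uv ^+ 2)); last by ring.
by rewrite pmulr_rge0// subr_ge0.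
Qed.

End InnerProducts.

(** * The fibrewise Randers norm *)

Section RandersNorm.
Context {R : realType} {n : nat} (A : 'M[R]_n) (X : 'rV[R]_n).
Hypotheses (A_sym : A^T = A) (A_pos : posdef A).
Hypothesis X_lt1 : Num.sqrt (inner A X X) < 1.
Implicit Types u v w y : 'rV[R]_n.

Definition rnorm v : R := Num.sqrt (inner A v v).

Definition randers_norm v : R := rnorm v + inner A X v.

(** The differential of [randers_norm] at [v]. *)
Definition randers_d v w : R := inner A v w / rnorm v + inner A X w.

(** The Hessian of [rnorm] at [v]. *)
Definition angular v u w : R :=
  inner A u w / rnorm v - inner A v u * inner A v w / rnorm v ^+ 3.

(** Half the Hessian of the square of [randers_norm] at [v]. *)
Definition randers_tensor v u w : R :=
  randers_d v u * randers_d v w + randers_norm v * angular v u w.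

Lemma rnorm_gt0 v : v != 0 -> 0 < rnorm v.
Proof. by move=> v0; rewrite sqrtr_gt0 A_pos. Qed.

Lemma rnorm_sqr v : rnorm v ^+ 2 = inner A v v.
Proof. by rewrite sqr_sqrtr// inner_ge0. Qed.

Lemma rnormN v : rnorm (- v) = rnorm v.
Proof. by rewrite /rnorm !innerE opprK. Qed.

(** Cauchy-Schwarz and [|X| < 1] give [|beta v| < alpha v]. *)
Lemma randers_norm_gt0 v : v != 0 -> 0 < randers_norm v.
Proof.
move=> v0; have v_gt0 := rnorm_gt0 v0.
suff: `|inner A X v| < rnorm v.
  rewrite ltr_norml /randers_norm => /andP[+ _].
  by rewrite -subr_gt0 opprK addrC.
rewrite -(@ltr_pXn2r _ 2)// ?nnegrE// ?ltW//.
rewrite -normrX ger0_norm ?sqr_ge0//.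
apply: le_lt_trans (cauchy_schwarz_inner _ _ A_sym A_pos) _.
rewrite rnorm_sqr gtr_pMl ?A_pos// -(sqr_sqrtr (inner_ge0 X A_pos)).
by rewrite -(expr1n _ 2) ltr_pXn2r// nnegrE ?sqrtr_ge0.
Qed.

Lemma angularDl v u1 u2 w :
  angular v (u1 + u2) w = angular v u1 w + angular v u2 w.
Proof. by rewrite /angular !innerE; ring. Qed.

Lemma angularZl v k u w : angular v (k *: u) w = k * angular v u w.
Proof. by rewrite /angular !innerE; ring. Qed.

Lemma angularC v u w : angular v u w = angular v w u.
Proof. by rewrite /angular (innerC u w A_sym); ring. Qed.

(** [rnorm] is positively homogeneous of degree one, so its Hessian kills the
    radial direction; this is what separates the part of the spray along [v]
    from the transverse part. *)
Lemma angular_self v w : v != 0 -> angular v v w = 0.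
Proof.
move=> /rnorm_gt0 /lt0r_neq0 v0; rewrite /angular -rnorm_sqr.
by field.
Qed.

Lemma angularN v u w : angular (- v) u w = angular v u w.
Proof. by rewrite /angular rnormN !innerE; ring. Qed.

Lemma randers_dD v u w : randers_d v (u + w) = randers_d v u + randers_d v w.
Proof. by rewrite /randers_d !innerE; ring. Qed.

Lemma randers_dZ v k w : randers_d v (k *: w) = k * randers_d v w.
Proof. by rewrite /randers_d !innerE; ring. Qed.

Lemma randers_d_self v : v != 0 -> randers_d v v = randers_norm v.
Proof.
move=> /rnorm_gt0 /lt0r_neq0 v0.
by rewrite /randers_d /randers_norm -rnorm_sqr; field.
Qed.

Lemma randers_tensorC v u w : randers_tensor v u w = randers_tensor v w u.
Proof. by rewrite /randers_tensor angularC; ring. Qed.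

Lemma randers_tensorDl v u1 u2 w :
  randers_tensor v (u1 + u2) w = randers_tensor v u1 w + randers_tensor v u2 w.
Proof. by rewrite /randers_tensor randers_dD angularDl; ring. Qed.

Lemma randers_tensorZl v k u w :
  randers_tensor v (k *: u) w = k * randers_tensor v u w.
Proof. by rewrite /randers_tensor randers_dZ angularZl; ring. Qed.

Lemma randers_tensor_self v u : v != 0 ->
  randers_tensor v u v = randers_norm v * randers_d v u.
Proof.
move=> v0; rewrite /randers_tensor angularC angular_self// randers_d_self//.
by ring.
Qed.

(** Testing against [v] kills the angular term and gives the first equation;
    the second is what remains. *)
Lemma randers_tensor_split v u : v != 0 ->
  (forall w, randers_tensor v u w = 0) ->
  randers_d v u = 0 /\ forall w, angular v u w = 0.
Proof.
move=> v0 gu; have F0 := lt0r_neq0 (randers_norm_gt0 v0).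
have du : randers_d v u = 0.
  apply: (mulfI F0); rewrite mulr0 -randers_tensor_self//.
split=> // w; apply: (mulfI F0).
by have := gu w; rewrite /randers_tensor du mul0r add0r mulr0.
Qed.

(** The angular part vanishes on [u] only if [u] is radial, and then
    [randers_d v u = 0] forces [u = 0] by positivity of the norm. *)
Lemma randers_tensor_nondegenerate v u : v != 0 ->
  (forall w, randers_tensor v u w = 0) -> u = 0.
Proof.
move=> v0 /(randers_tensor_split v0)[du hu].
have r0 := lt0r_neq0 (rnorm_gt0 v0).
(* The candidate multiple of [v] is the orthogonal projection of [u]. *)
have uE : u = (inner A v u / rnorm v ^+ 2) *: v.
  apply/eqP; rewrite -subr_eq0; apply/eqP; apply: (inner_nondegenerate A_pos).
  move=> w; apply: (mulfI (invr_neq0 r0)); rewrite mulr0 -[RHS](hu w).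
  by rewrite /angular !innerE; field.
move: du; rewrite uE randers_dZ randers_d_self// => /eqP.
rewrite mulf_eq0 (gt_eqF (randers_norm_gt0 v0)) orbF => /eqP ->.
by rewrite scale0r.
Qed.

Lemma is_derive_rnorm v w : v != 0 ->
  is_derive v w rnorm (inner A v w / rnorm v).
Proof.
move=> v0; have := is_derive_inner (is_derive_cst A v w) (is_derive_id v w)
  (is_derive_id v w) => H.
have S := is_derive1_sqrt (A_pos v0).
apply: (is_derive_eq (is_derive_comp1 H S)).
rewrite !innerE /= add0r (innerC w v A_sym) -/(rnorm v).
have r0 := lt0r_neq0 (rnorm_gt0 v0).
by field.
Qed.

Lemma is_derive_linear_form (Z : 'rV[R]_n) v w :
  is_derive v w (fun v => inner A Z v) (inner A Z w).
Proof.
have := is_derive_inner (is_derive_cst A v w) (is_derive_cst Z v w)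
  (is_derive_id v w) => H.
by apply: (is_derive_eq H); rewrite !innerE /= !add0r.
Qed.

Lemma is_derive_randers v w : v != 0 ->
  is_derive v w randers_norm (randers_d v w).
Proof.
by move=> v0; apply: is_deriveD; [exact: is_derive_rnorm|
  exact: is_derive_linear_form].
Qed.

Lemma is_derive_randers_sqr v w : v != 0 ->
  is_derive v w (fun v => randers_norm v ^+ 2)
    (2 * randers_norm v * randers_d v w).
Proof.
move=> v0; have H := is_derive_randers w v0.
rewrite (_ : (fun v => _) = randers_norm * randers_norm); last first.
  by apply/funext => u; rewrite expr2.
by apply: (is_derive_eq (is_deriveM H H)); rewrite /GRing.scale/=; ring.
Qed.

Lemma is_derive_rnormV v w : v != 0 ->
  is_derive v w (fun v => (rnorm v)^-1) (- inner A v w / rnorm v ^+ 3).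
Proof.
move=> v0; have r0 := lt0r_neq0 (rnorm_gt0 v0).
have [rd rE] := is_derive_rnorm w v0.
have K : is_derive v w (fun v => (rnorm v)^-1) (- rnorm v ^- 2 *: 'D_w rnorm v).
  by split; [exact: derivableV|exact: deriveV].
by apply: (is_derive_eq K); rewrite rE /GRing.scale/=; field.
Qed.

Lemma is_derive_randers_d v u w : v != 0 ->
  is_derive v u (fun v => randers_d v w) (angular v u w).
Proof.
move=> v0; have r0 := lt0r_neq0 (rnorm_gt0 v0).
have H1 : is_derive v u (fun v => inner A v w) (inner A u w).
  have := is_derive_inner (is_derive_cst A v u) (is_derive_id v u)
    (is_derive_cst w v u) => H.
  by apply: (is_derive_eq H); rewrite !innerE /= add0r addr0.
have := is_deriveD (is_deriveM H1 (is_derive_rnormV u v0))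
  (is_derive_cst (inner A X w) v u) => K.
by apply: (is_derive_eq K); rewrite /angular /GRing.scale/=; field.
Qed.

Lemma is_derive_randers_sqr_d v u w : v != 0 ->
  is_derive v u (fun v => 2 * randers_norm v * randers_d v w)
    (2 * randers_tensor v u w).
Proof.
move=> v0.
have K := is_deriveM
   (is_deriveM (is_derive_cst (2 : R) v u) (is_derive_randers u v0))
   (is_derive_randers_d u w v0).
apply: (is_derive_eq K); rewrite /randers_tensor /GRing.scale/=.
by rewrite /cst !fctE; ring.
Qed.

End RandersNorm.

(** * The spray of a Randers metric *)

Lemma near_neq0 {R : realType} {n : nat} (v : 'rV[R]_n) : v != 0 ->
  \forall z \near v, z != 0.
Proof.
move=> v0; have : open_nbhs v [set z | z != 0].
  split=> //; rewrite (_ : [set z | _] = ~` [set 0]).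
    apply/closed_openC/accessible_closed_set1/hausdorff_accessible.
    exact: norm_hausdorff.
  by apply/seteqP; split=> z /eqP.
by move=> /open_nbhs_nbhs.
Qed.

Section RandersSpray.
Context {R : realType} {n : nat}.
Variables (a : 'rV[R]_n -> 'M[R]_n) (X : 'rV[R]_n -> 'rV[R]_n).
Variables (U : set 'rV[R]_n) (x : 'rV[R]_n).
Hypotheses (U_open : open U) (Ux : U x).
Variables (dmetric : 'rV[R]_n -> 'M[R]_n) (dfield : 'rV[R]_n -> 'rV[R]_n).
Hypothesis a_derive : forall u, is_derive x u a (dmetric u).
Hypothesis X_derive : forall u, is_derive x u X (dfield u).
Hypotheses (dmetricD : {morph dmetric : u v / u + v})
  (dmetricZ : forall k, {morph dmetric : u / k *: u})
  (dfieldD : {morph dfield : u v / u + v})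
  (dfieldZ : forall k, {morph dfield : u / k *: u}).
Hypothesis a_sym : forall z, U z -> (a z)^T = a z.
Hypothesis a_pos : posdef (a x).
Hypothesis X_lt1 : Num.sqrt (inner (a x) (X x) (X x)) < 1.
Implicit Types u v w y z : 'rV[R]_n.

Local Notation A := (a x).
Local Notation F := (randers_norm A (X x)).

Let A_sym : A^T = A. Proof. exact: a_sym. Qed.

(** The derivative at [x] along [u] of the one-form dual to [X], on [v]. *)
Definition dform u v : R :=
  inner (dmetric u) (X x) v + inner A (dfield u) v.

(** The derivative at [x] along [u] of the Randers norm of a fixed [v]. *)
Definition dnorm u v : R :=
  inner (dmetric u) v v / (2 * rnorm A v) + dform u v.

(** The mixed derivative of the Randers norm: along [u] in the base and along
    [w] in the fibre. *)
Definition ddnorm u v w : R :=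
  inner (dmetric u) v w / rnorm A v
  - inner (dmetric u) v v * inner A v w / (2 * rnorm A v ^+ 3) + dform u w.

Lemma dmetric_sym u : (dmetric u)^T = dmetric u.
Proof.
rewrite -(@derive_val _ _ _ _ _ _ _ (is_derive_trmx (a_derive u))).
rewrite -[RHS](@derive_val _ _ _ _ _ _ _ (a_derive u)).
by apply: (derive_eq_on _ U_open _ Ux) => z; apply: a_sym.
Qed.

Lemma dformDl u1 u2 v : dform (u1 + u2) v = dform u1 v + dform u2 v.
Proof. by rewrite /dform dmetricD dfieldD !innerE; ring. Qed.

Lemma dformZl k u v : dform (k *: u) v = k * dform u v.
Proof. by rewrite /dform dmetricZ dfieldZ !innerE; ring. Qed.

Lemma dformDr u v1 v2 : dform u (v1 + v2) = dform u v1 + dform u v2.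
Proof. by rewrite /dform !innerE; ring. Qed.

Lemma dformZr k u v : dform u (k *: v) = k * dform u v.
Proof. by rewrite /dform !innerE; ring. Qed.

Lemma dnormDl u1 u2 v : dnorm (u1 + u2) v = dnorm u1 v + dnorm u2 v.
Proof. by rewrite /dnorm dmetricD dformDl !innerE; ring. Qed.

Lemma dnormZl k u v : dnorm (k *: u) v = k * dnorm u v.
Proof. by rewrite /dnorm dmetricZ dformZl !innerE; ring. Qed.

Lemma ddnormDl u1 u2 v w :
  ddnorm (u1 + u2) v w = ddnorm u1 v w + ddnorm u2 v w.
Proof. by rewrite /ddnorm dmetricD dformDl !innerE; ring. Qed.

Lemma ddnormZl k u v w : ddnorm (k *: u) v w = k * ddnorm u v w.
Proof. by rewrite /ddnorm dmetricZ dformZl !innerE; ring. Qed.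

Lemma ddnormDr u v w1 w2 :
  ddnorm u v (w1 + w2) = ddnorm u v w1 + ddnorm u v w2.
Proof. by rewrite /ddnorm dformDr !innerE; ring. Qed.

Lemma ddnormZr k u v w : ddnorm u v (k *: w) = k * ddnorm u v w.
Proof. by rewrite /ddnorm dformZr !innerE; ring. Qed.

(** Euler's relation: [dnorm u] is positively homogeneous of degree one. *)
Lemma ddnorm_self u v : v != 0 -> ddnorm u v v = dnorm u v.
Proof.
move=> v0; have r0 := lt0r_neq0 (rnorm_gt0 a_pos v0).
by rewrite /ddnorm /dnorm -(rnorm_sqr a_pos); field.
Qed.

Lemma is_derive_metric u v w :
  is_derive x u (fun z => inner (a z) v w) (inner (dmetric u) v w).
Proof.
have H := is_derive_inner (a_derive u)
  (is_derive_cst v x u) (is_derive_cst w x u).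
by apply: (is_derive_eq H); rewrite !innerE !addr0.
Qed.

Lemma is_derive_form u v :
  is_derive x u (fun z => inner (a z) (X z) v) (dform u v).
Proof.
have H := is_derive_inner (a_derive u)
  (X_derive u) (is_derive_cst v x u).
by apply: (is_derive_eq H); rewrite !innerE !addr0.
Qed.

Lemma is_derive_base u v : v != 0 ->
  is_derive x u (fun z => randers_norm (a z) (X z) v ^+ 2)
    (2 * F v * dnorm u v).
Proof.
move=> v0; have r0 := lt0r_neq0 (rnorm_gt0 a_pos v0).
have S := is_derive1_sqrt (a_pos v0).
have H := is_deriveD (is_derive_comp1 (is_derive_metric u v v) S)
  (is_derive_form u v).
set f := _ + _ in H.
rewrite (_ : (fun z => _) = f * f); last by apply/funext => z; rewrite expr2.
apply: (is_derive_eq (is_deriveM H H)).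
rewrite /f /GRing.scale/= -/(rnorm A v) /dnorm !fctE /= /randers_norm.
by rewrite -/(rnorm A v); field.
Qed.

Lemma is_derive_dnorm u v w : v != 0 ->
  is_derive v w (dnorm u) (ddnorm u v w).
Proof.
move=> v0; have r0 := lt0r_neq0 (rnorm_gt0 a_pos v0).
have H1 := is_derive_inner (is_derive_cst (dmetric u) v w) (is_derive_id v w)
  (is_derive_id v w).
have H2 := is_deriveM H1 (is_derive_rnormV A_sym a_pos w v0).
have H3 := is_deriveD (is_deriveM (is_derive_cst (2^-1 : R) v w) H2)
  (is_deriveD (is_derive_linear_form (dmetric u) (X x) v w)
     (is_derive_linear_form A (dfield u) v w)).
set f := _ + _ in H3.
rewrite (_ : dnorm u = f); last first.
  by apply/funext => z; rewrite /dnorm /dform invfM mulrCA.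
apply: (is_derive_eq H3).
rewrite /ddnorm /dform /GRing.scale/= !innerE /cst !fctE.
by rewrite (innerC w v (dmetric_sym u)); field.
Qed.

Definition coordinate_tensor y : 'M[R]_n :=
  \matrix_(i, j) (2^-1 * 'D_(delta_mx 0 i)
    (fun v => 'D_(delta_mx 0 j) (fun w => F w ^+ 2) v) y).

(** The expression of the spray in one chart, for metric coefficients [a] and
    field components [X] that need not come from a manifold. *)
Definition coordinate_spray y : 'rV[R]_n :=
  \row_i (4^-1 * \sum_l invmx (coordinate_tensor y) i l *
    (\sum_m 'D_(delta_mx 0 l) (fun v => 'D_(delta_mx 0 m)
        (fun z => randers_norm (a z) (X z) v ^+ 2) x) y * y 0 m
     - 'D_(delta_mx 0 l) (fun z => randers_norm (a z) (X z) y ^+ 2) x)).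

Lemma inner_coordinate_tensor y u w : y != 0 ->
  inner (coordinate_tensor y) u w = randers_tensor A (X x) y u w.
Proof.
move=> y0.
rewrite -(inner_matrix (phi := randers_tensor A (X x) y)); first last.
- by move=> k v z; rewrite randers_tensorC// randers_tensorZl randers_tensorC.
- by move=> v1 v2 z; rewrite randers_tensorC// randers_tensorDl
    [X in X + _]randers_tensorC// [X in _ + X]randers_tensorC.
- by move=> k v z; rewrite randers_tensorZl.
- by move=> v1 v2 z; rewrite randers_tensorDl.
congr (inner _ u w); apply/matrixP => i j; rewrite !mxE.
rewrite (near_eq_derive (g := fun v => 2 * F v *
  randers_d A (X x) v (delta_mx 0 j))); last first.
  near=> v; apply: derive_val; apply: is_derive_randers_sqr => //.
  by near: v; exact: near_neq0.
have H := is_derive_randers_sqr_d (X x) A_sym a_pos (delta_mx 0 i)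
  (delta_mx 0 j) y0.
by rewrite (@derive_val _ _ _ _ _ _ _ H) mulrA mulVf ?mul1r// pnatr_eq0.
Unshelve. all: by end_near. Qed.

Lemma coordinate_tensor_sym y : y != 0 ->
  (coordinate_tensor y)^T = coordinate_tensor y.
Proof.
move=> y0; apply/matrixP => i j; rewrite mxE.
have E k l : coordinate_tensor y k l =
    inner (coordinate_tensor y) (delta_mx 0 k) (delta_mx 0 l).
  by rewrite /inner -rowE trmx_delta -colE !mxE.
by rewrite !E !inner_coordinate_tensor// randers_tensorC.
Qed.

(** Nondegeneracy is what makes the inverse matrix in the spray a genuine
    inverse. *)
Lemma coordinate_tensor_unit y : y != 0 -> coordinate_tensor y \in unitmx.
Proof.
move=> y0; rewrite -row_free_unit; apply: inj_row_free => v vg.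
apply: (randers_tensor_nondegenerate A_sym a_pos X_lt1 y0) => w.
by rewrite -inner_coordinate_tensor// /inner vg mul0mx mxE.
Qed.

(** Half of the covector to which the inverse fundamental tensor is applied in
    the spray. *)
Definition euler_lagrange y w : R :=
  randers_d A (X x) y w * dnorm y y + F y * (ddnorm y y w - dnorm w y).

(** The sum over [m] is a derivative along [y] in the base, by linearity. *)
Lemma spray_covector y l : y != 0 ->
  \sum_m 'D_(delta_mx 0 l) (fun v => 'D_(delta_mx 0 m)
        (fun z => randers_norm (a z) (X z) v ^+ 2) x) y * y 0 m
     - 'D_(delta_mx 0 l) (fun z => randers_norm (a z) (X z) y ^+ 2) x =
  2 * euler_lagrange y (delta_mx 0 l).
Proof.
move=> y0; set e := delta_mx 0 l.
rewrite (@derive_val _ _ _ _ _ _ _ (is_derive_base e y0)).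
have E m : 'D_e (fun v => 'D_(delta_mx 0 m)
        (fun z => randers_norm (a z) (X z) v ^+ 2) x) y =
    2 * (randers_d A (X x) y e * dnorm (delta_mx 0 m) y
         + F y * ddnorm (delta_mx 0 m) y e).
  rewrite (near_eq_derive (g := fun v => 2 * F v * dnorm (delta_mx 0 m) v)).
    have K := is_deriveM (is_deriveM (is_derive_cst (2 : R) y e)
      (is_derive_randers (X x) A_sym a_pos e y0))
      (is_derive_dnorm (delta_mx 0 m) e y0).
    rewrite (@derive_val _ _ _ _ _ _ _ K) /GRing.scale/= /cst !fctE.
    by ring.
  near=> v; apply: derive_val; apply: is_derive_base.
  by near: v; exact: near_neq0.
under eq_bigr do rewrite E.
rewrite /euler_lagrange.
rewrite (linear_row (phi := fun u => dnorm u y) y); first last.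
- by move=> k u; exact: dnormZl.
- by move=> u v; exact: dnormDl.
rewrite (linear_row (phi := fun u => ddnorm u y e) y); first last.
- by move=> k u; exact: ddnormZl.
- by move=> u v; exact: ddnormDl.
set S1 := \sum_i y 0 i * dnorm _ _; set S2 := \sum_i y 0 i * ddnorm _ _ _.
rewrite (_ : \sum_i _ = 2 * (randers_d A (X x) y e * S1 + F y * S2)).
  by ring.
rewrite !mulr_sumr -big_split mulr_sumr; apply: eq_bigr => m _ /=.
by ring.
Unshelve. all: by end_near. Qed.

Lemma coordinate_sprayP y w : y != 0 ->
  2 * randers_tensor A (X x) y (coordinate_spray y) w = euler_lagrange y w.
Proof.
move=> y0; pose r := \row_l (2 * euler_lagrange y (delta_mx 0 l)).
set g := coordinate_tensor y.
have SE : coordinate_spray y = 4^-1 *: (r *m invmx g).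
  apply/rowP => i; rewrite !mxE; congr (_ * _); apply: eq_bigr => l _.
  rewrite spray_covector// mxE mulrC; congr (_ * _).
  by rewrite -[in LHS](coordinate_tensor_sym y0) -/g -trmx_inv mxE.
rewrite -inner_coordinate_tensor// SE innerZl /inner.
rewrite mulmxKV ?coordinate_tensor_unit// mxE.
rewrite [RHS](linear_row (phi := euler_lagrange y)); first last.
- move=> k u.
  by rewrite /euler_lagrange randers_dZ ddnormZr dnormZl; ring.
- move=> u v.
  by rewrite /euler_lagrange randers_dD ddnormDr dnormDl; ring.
rewrite !mulr_sumr; apply: eq_bigr => i _; rewrite !mxE.
by field.
Qed.

(** Contraction with [w = y] gives the first equation, as the angular term
    vanishes there; substituting it back leaves the second. *)
Lemma coordinate_spray_split y : y != 0 ->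
  2 * randers_d A (X x) y (coordinate_spray y) = dnorm y y /\
  forall w, 2 * angular A y (coordinate_spray y) w = ddnorm y y w - dnorm w y.
Proof.
move=> y0; have F0 := lt0r_neq0 (randers_norm_gt0 A_sym a_pos X_lt1 y0).
have H := coordinate_sprayP _ y0.
have dS : 2 * randers_d A (X x) y (coordinate_spray y) = dnorm y y.
  apply: (mulfI F0); have := H y.
  rewrite /euler_lagrange randers_tensor_self// ddnorm_self// randers_d_self//.
  by rewrite subrr mulr0 addr0 => <-; ring.
split=> // w; apply: (mulfI F0); have := H w.
by rewrite /euler_lagrange -dS /randers_tensor; move=> h; lra.
Qed.

(** The metric terms of the transverse equation are even in [y] and cancel;
    those of the one-form are odd and double. *)
Lemma even_odd_spray y w : y != 0 ->
  2 * angular A y (coordinate_spray y) w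
    - 2 * angular A (- y) (coordinate_spray (- y)) w =
  2 * (dform y w - dform w y).
Proof.
move=> y0; have Ny0 : - y != 0 by rewrite oppr_eq0.
have [_ ->] := coordinate_spray_split y0.
have [_ ->] := coordinate_spray_split Ny0.
have dmN u : dmetric (- u) = - dmetric u by rewrite -scaleN1r dmetricZ scaleN1r.
have dfNl u v : dform (- u) v = - dform u v.
  by rewrite -scaleN1r dformZl mulN1r.
have dfNr u v : dform u (- v) = - dform u v.
  by rewrite -scaleN1r dformZr mulN1r.
by rewrite /ddnorm /dnorm rnormN dmN dfNl dfNr !innerE; ring.
Qed.

(** The angular form does not see the direction of [y], so the left-hand side
    of [even_odd_spray] is zero and the one-form is closed. *)
Lemma closed_of_parallel y k : y != 0 ->
  coordinate_spray y - coordinate_spray (- y) = k *: y ->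
  forall w, dform y w = dform w y.
Proof.
move=> y0 Sy w; apply/eqP; rewrite -subr_eq0; apply/eqP.
have two0 : (2 : R) != 0 by rewrite pnatr_eq0.
apply: (mulfI two0); rewrite mulr0 -even_odd_spray// angularN -mulrBr.
rewrite (_ : _ - _ = angular A y (k *: y) w).
  by rewrite angularZl angular_self// !mulr0.
by rewrite -Sy angularDl -[- coordinate_spray _]scaleN1r angularZl mulN1r.
Qed.

(** The hypotheses on [v] say that [alpha y] and [beta y] are constant along
    the motion, hence the component of the equation along [y] holds.  Closedness
    removes the one-form from the transverse component, which leaves the
    Lagrange form of the Riemannian geodesic equation. *)
Lemma geodesic_equationP y v : y != 0 ->
  (forall w, dform y w = dform w y) ->
  inner (dmetric y) y y + 2 * inner A y v = 0 ->
  dform y y + inner A (X x) v = 0 ->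
  v + 2 *: coordinate_spray y = 0 <->
  forall w, inner A v w + inner (dmetric y) y w
            - 2^-1 * inner (dmetric w) y y = 0.
Proof.
move=> y0 closed yv Xv; set S := coordinate_spray y.
have r0 := lt0r_neq0 (rnorm_gt0 a_pos y0).
have [dS hS] := coordinate_spray_split y0.
have d0 : randers_d A (X x) y (v + 2 *: S) = 0.
  rewrite randers_dD randers_dZ dS /randers_d /dnorm.
  have -> : inner (dmetric y) y y = - 2 * inner A y v by lra.
  have -> : dform y y = - inner A (X x) v by lra.
  by field.
have hE w : angular A y (v + 2 *: S) w =
    (inner A v w + inner (dmetric y) y w - 2^-1 * inner (dmetric w) y y)
    / rnorm A y.
  rewrite angularDl angularZl hS /angular /ddnorm /dnorm closed.
  have -> : inner (dmetric y) y y = - 2 * inner A y v by lra.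
  by field.
split=> [vS w|el].
  have := hE w; rewrite vS /angular !innerE !mul0r subr0 => /esym/eqP.
  by rewrite mulf_eq0 invr_eq0 (negbTE r0) orbF => /eqP.
apply: (randers_tensor_nondegenerate A_sym a_pos X_lt1 y0) => w.
by rewrite /randers_tensor d0 hE el !mul0r mulr0 addr0.
Qed.

End RandersSpray.

(** * The Koszul formula for invariant fields *)

(** Differentiate the two constant products along [E] and along [Y]: the
    derivatives of the metric turn into derivatives of the fields, which
    assemble into the bracket. *)
Lemma frame_geodesic_form {R : realType} {n : nat}
    (a : 'rV[R]_n -> 'M[R]_n) (Y E : 'rV[R]_n -> 'rV[R]_n)
    (U : set 'rV[R]_n) (x : 'rV[R]_n) (k1 k2 : R) :
  open U -> U x -> (forall z, U z -> (a z)^T = a z) ->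
  differentiable a x -> differentiable Y x -> differentiable E x ->
  (forall z, U z -> inner (a z) (Y z) (Y z) = k1) ->
  (forall z, U z -> inner (a z) (Y z) (E z) = k2) ->
  inner (a x) ('D_(Y x) Y x) (E x) + inner ('D_(Y x) a x) (Y x) (E x)
    - 2^-1 * inner ('D_(E x) a x) (Y x) (Y x) =
  inner (a x) (Y x) ('D_(E x) Y x - 'D_(Y x) E x).
Proof.
move=> U_open Ux a_sym ad Yd Ed YY YE.
have DaY := derivableP (diff_derivable (v := Y x) ad).
have DaE := derivableP (diff_derivable (v := E x) ad).
have DYY := derivableP (diff_derivable (v := Y x) Yd).
have DYE := derivableP (diff_derivable (v := E x) Yd).
have DEY := derivableP (diff_derivable (v := Y x) Ed).
have H1 := @derive_val _ _ _ _ _ _ _ (is_derive_inner DaY DYY DEY).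
have H2 := @derive_val _ _ _ _ _ _ _ (is_derive_inner DaE DYE DYE).
rewrite (derive_cst_on _ U_open YE Ux) in H1.
rewrite (derive_cst_on _ U_open YY Ux) in H2.
move: ('D_(Y x) a x) ('D_(E x) a x) ('D_(Y x) Y x) ('D_(E x) Y x)
  ('D_(Y x) E x) H1 H2 => aY aE YdY YdE EdY.
rewrite innerDr innerNr (innerC YdE (Y x) (a_sym x Ux)) => H1 H2.
lra.
Qed.

(** * Curves and left translations *)

Section LieGroupCalculus.
Context {R : realType} {n : nat} {G : lieGroup R n}.
Implicit Types (c d : chart R n G) (g : G) (Y : vfield G) (gam : R -> G).

Lemma atlas_cover g : exists2 c, @atlas _ _ G c & dom c g.
Proof. by have [+ _ _] := atlas_maximal G; apply. Qed.

Lemma vfield_differentiable Y c x : left_invariant Y -> atlas c -> cod c x ->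
  differentiable (Y c) x.
Proof. by move=> [[Ys _] _] /Ys /(_ 1)[Yd _] /Yd. Qed.

Lemma metric_differentiable (a : tensor2 G) c x : left_invariant_metric a ->
  atlas c -> cod c x -> differentiable (a c) x.
Proof. by move=> [[ads _ _ _] _] /ads /(_ 1)[ad _] /ad. Qed.

Lemma ltranslation_differentiable g c d x : atlas c -> atlas d ->
  ltranslation_dom g c d x -> differentiable (ltranslation g c d) x.
Proof.
move=> ca da [cx dx]; have [b ba bg] := atlas_cover g.
have [+ _] := mul_smooth ba ca da 1.
move=> /(_ (coord b g, x)) /=; rewrite coordK// => /(_ _)/wrap[].
  by split=> //; exact: coord_cod.
move=> md.
have pd : differentiable (fun z : 'rV[R]_n => (coord b g, z)) x.
  by apply: differentiable_pair => //; exact: differentiable_cst.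
have -> : ltranslation g c d =
    (fun z => coord d (pt b z.1 * pt c z.2)%g) \o (fun z => (coord b g, z)).
  by apply/funext => z; rewrite /ltranslation /= coordK.
exact: differentiable_comp.
Qed.

Lemma near_dom c gam t : {for t, continuous gam} -> dom c (gam t) ->
  \forall s \near t, dom c (gam s).
Proof.
move=> gc cg; apply: gc; apply: open_nbhs_nbhs; split=> //; exact: open_dom.
Qed.

(** An integral curve of a left invariant field is carried to an integral curve
    by left translations. *)
Lemma is_derive_ltranslation Y gam g c d t : left_invariant Y ->
  atlas c -> atlas d -> {for t, continuous gam} ->
  dom c (gam t) -> dom d (g * gam t)%g ->
  is_derive t 1 (coord c \o gam) (Y c (coord c (gam t))) ->
  is_derive t 1 (fun s => coord d (g * gam s)%g) (Y d (coord d (g * gam t)%g)).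
Proof.
move=> [_ Yinv] ca da gc cg dg [cd cE].
have T : ltranslation_dom g c d (coord c (gam t)).
  by split; rewrite ?coordK//; exact: coord_cod.
have ld := ltranslation_differentiable ca da T.
have cd' : differentiable (coord c \o gam) t by apply/derivable1_diffP.
have fd := differentiable_comp cd' ld.
apply: (@near_eq_is_derive _ _ _ (ltranslation g c d \o (coord c \o gam))).
  near=> s; rewrite /ltranslation /= coordK//.
  by near: s; exact: near_dom.
split; first exact: diff_derivable.
rewrite derive_comp// cE -Yinv// /ltranslation coordK//.
Unshelve. all: by end_near. Qed.

(** [gam (t + s) = gam t * gam s], so the velocity at [t] is the translate of
    the velocity at [0]. *)
Lemma is_derive_one_parameter Y gam c d t : left_invariant Y ->
  atlas c -> atlas d -> {for 0, continuous gam} ->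
  (forall s t, gam (s + t) = (gam s * gam t)%g) ->
  dom c (gam 0) -> dom d (gam t) ->
  is_derive (0 : R) 1 (coord c \o gam) (Y c (coord c (gam 0))) ->
  is_derive t 1 (coord d \o gam) (Y d (coord d (gam t))).
Proof.
move=> Yinv ca da gc gamD c0 dt c'0.
have dt' : dom d (gam t * gam 0)%g by rewrite -gamD addr0.
have := is_derive_ltranslation Yinv ca da gc c0 dt' c'0.
rewrite -gamD addr0 => -[H HE].
have E : (fun h : R => (coord d \o gam) (h *: 1 + t)) =
    (fun s => coord d (gam t * gam s)%g).
  by apply/funext => s /=; rewrite -gamD [s *: 1]mulr1 addrC.
by split; [apply/derivable1P; rewrite E|rewrite derive_line E].
Qed.

Lemma hom_one gam : (forall s t, gam (s + t) = (gam s * gam t)%g) ->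
  gam 0 = 1%g.
Proof. by move=> gamD; apply: (mulgI (gam 0)); rewrite -gamD addr0 mulg1. Qed.

Lemma exp_curve_derive Y gam c t : left_invariant Y -> exp_curve Y gam ->
  atlas c -> dom c (gam t) ->
  is_derive t 1 (coord c \o gam) (Y c (coord c (gam t))).
Proof.
move=> Yinv [[gc gs] gamD g'0] ca ct; have [b ba b1] := atlas_cover 1%g.
have g0 := hom_one gamD.
have bd : derivable (coord b \o gam) 0 1.
  have [bd _] := gs b ba 1; apply: diff_derivable; apply: bd.
  by rewrite /= g0.
apply: (is_derive_one_parameter Yinv ba ca _ gamD) => //; rewrite ?g0//.
  exact: gc.
by rewrite -g'0// derive1E; exact: derivableP.
Qed.

Lemma exp_curve_derive2 Y gam c t : left_invariant Y -> exp_curve Y gam ->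
  atlas c -> dom c (gam t) ->
  let x := coord c \o gam in
  derive1 x t = Y c (x t) /\ derive1n 2 x t = 'D_(Y c (x t)) (Y c) (x t).
Proof.
move=> Yinv Yexp ca ct x.
have D s : dom c (gam s) -> is_derive s 1 x (Y c (x s)).
  by move=> cs; exact: exp_curve_derive.
have x' : 'D_1 x t = Y c (x t) by have [] := D t ct.
split; first by rewrite derive1E.
rewrite derive1nS derive1n1 derive1E.
have gc : {for t, continuous gam} by have [[+ _] _ _] := Yexp; apply.
rewrite (near_eq_derive (g := Y c \o x)); last first.
  near=> s; rewrite derive1E.
  by have [] := D s _; last by []; near: s; exact: near_dom.
rewrite derive_comp ?x'//.
  by apply/derivable1_diffP; have [] := D t ct.
by apply: vfield_differentiable => //; exact: coord_cod.
Unshelve. all: by end_near. Qed.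

End LieGroupCalculus.

(** * Primitives and mean value estimates *)

Section OrdinaryDifferentialEquations.
Context {R : realType} {n : nat}.
Implicit Types (r s t : R) (u z : R -> 'rV[R]_n) (v w : 'rV[R]_n -> 'rV[R]_n).

Lemma rV_norm_le (x : 'rV[R]_n) k : 0 <= k ->
  (forall i, `|x 0 i| <= k) -> `|x| <= k.
Proof.
move=> k0 xk; rewrite [leLHS]/Num.Def.normr/= mx_normrE.
by apply: bigmax_le => //= -[i j] _ /=; rewrite ord1.
Qed.

Lemma rV_coord_le (x : 'rV[R]_n) i : `|x 0 i| <= `|x|.
Proof.
rewrite [leRHS]/Num.Def.normr/= mx_normrE.
exact: (le_bigmax _ (fun ij => `|x ij.1 ij.2|) (0, i)).
Qed.

(** Coordinatewise mean value theorem: the norm of row vectors is the supremum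
    norm, so no constant is lost. *)
Lemma mean_value_le (f df : R -> 'rV[R]_n) (a b K : R) : a <= b -> 0 <= K ->
  (forall t, a <= t <= b -> is_derive t 1 f (df t)) ->
  (forall t, a <= t <= b -> `|df t| <= K) ->
  `|f b - f a| <= K * (b - a).
Proof.
move=> ab K0 fd fK; apply: rV_norm_le => [|i].
  by rewrite mulr_ge0// subr_ge0.
have fdi t : a <= t <= b -> is_derive t 1 (fun t => f t 0 i) (df t 0 i).
  by move=> /fd /is_derive_mxP.
rewrite 2!mxE; have [t||t tab ->] :=
  @MVT_segment R (fun t => f t 0 i) (fun t => df t 0 i) a b ab.
- by move=> /andP[/ltW at_ /ltW tb]; apply: fdi; rewrite at_ tb.
- apply: derivable_within_continuous => t; rewrite in_itv/= => /fdi.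
  by case.
rewrite normrM [`|b - a|]ger0_norm ?subr_ge0// ler_wpM2r ?subr_ge0//.
by rewrite (le_trans (rV_coord_le _ _))// fK// -in_itv.
Qed.

Lemma mean_value_sym (f df : R -> 'rV[R]_n) (T K s t : R) : 0 <= K ->
  (forall t, `|t| < T -> is_derive t 1 f (df t)) ->
  (forall t, `|t| < T -> `|df t| <= K) ->
  `|s| < T -> `|t| < T -> `|f t - f s| <= K * `|t - s|.
Proof.
move=> K0 fd fK; wlog st : s t / s <= t => [H sT tT|].
  have [/H->//|/ltW/H H'] := leP s t.
  by rewrite distrC [`|t - s|]distrC H'.
rewrite !ltr_norml => /andP[Ts _] /andP[_ tT].
have I r : s <= r <= t -> `|r| < T.
  move=> /andP[sr rt]; rewrite ltr_norml.
  by rewrite (lt_le_trans Ts)//= (le_lt_trans rt).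
rewrite [`|t - s|]ger0_norm ?subr_ge0//.
apply: (mean_value_le (df := df)) => //.
  by move=> r /I /fd.
by move=> r /I /fK.
Qed.

(** The integral is started at [- T] so that all times considered are interior
    points, as the fundamental theorem of calculus requires. *)
Lemma exists_primitive (f : R -> R) (T : R) : 0 < T -> continuous f ->
  exists P : R -> R, forall t, `|t| < T -> is_derive t 1 P (f t).
Proof.
move=> T0 fc; exists (fun t => \int[lebesgue_measure]_(s in `[- T, t]) f s).
move=> t; rewrite ltr_norml => /andP[Tt tT].
have fi : lebesgue_measure.-integrable `[- T, T] (EFin \o f).
  apply: continuous_compact_integrable; first exact: segment_compact.
  exact: continuous_subspaceT.
have [Pd PE] := continuous_FTC1_closed tT fi Tt (fc t).
by split; [exact: Pd|rewrite -derive1E; exact: PE].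
Qed.

Lemma exists_primitive_rV (f : R -> 'rV[R]_n) (T : R) : 0 < T ->
  continuous f ->
  exists P : R -> 'rV[R]_n,
    P 0 = 0 /\ forall t, `|t| < T -> is_derive t 1 P (f t).
Proof.
move=> T0 fc.
have /choice[P PE] i : exists P : R -> R,
    forall t, `|t| < T -> is_derive t 1 P (f t 0 i).
  apply: exists_primitive => // t.
  apply: (@continuous_comp _ _ _ f (fun x : 'rV[R]_n => x 0 i)).
    exact: fc.
  exact: matrix_normedtype.coord_continuous.
exists (fun t => \row_i (P i t - P i 0)); split.
  by apply/rowP => i; rewrite !mxE subrr.
move=> t /PE tP; apply/is_derive_mxP => j i; rewrite ord1.
have -> : (fun s => (\row_k (P k s - P k 0)) 0 i) = P i - cst (P i 0).
  by apply/funext => s; rewrite mxE.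
by rewrite -[f t 0 i]subr0; apply: is_deriveB; exact: tP.
Qed.

Definition clamp (r t : R) : R := Num.max (- r) (Num.min t r).

Lemma clamp_le r t : 0 <= r -> `|clamp r t| <= r.
Proof.
move=> r0; rewrite ler_norml /clamp le_max lexx ge_max ge_min lexx orbT andbT/=.
by lra.
Qed.

Lemma clampK r t : `|t| <= r -> clamp r t = t.
Proof.
rewrite ler_norml => /andP[rt tr].
by rewrite /clamp (min_idPl tr) (max_idPr rt).
Qed.

Lemma clamp_lipschitz r s t : `|clamp r t - clamp r s| <= `|t - s|.
Proof.
have H (x y z : R) : `|x - y| <= z <-> x - y <= z /\ y - x <= z.
  by rewrite ler_norml; split=> [/andP[]|[]] *; [split|apply/andP; split]; lra.
have [] := (H t s _).1 (lexx _); move: `|t - s| => k h1 h2.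
by apply/H; rewrite /clamp; case: (leP t r) => ?; case: (leP s r) => ?;
  do 2?[case: (leP (- r) _) => ?]; split; lra.
Qed.

Lemma le_geometric (x y C : R) :
  (forall k : nat, x <= y + C / 2 ^+ k) -> x <= y.
Proof.
move=> H; apply/ler_addgt0Pr => e e0.
pose D := `|C| + 1; have D0 : 0 < D by rewrite ltr_wpDl.
have eD : 0 < e / D by rewrite divr_gt0.
have [k _ /(_ k (leqnn k)) /= kE] := near_infty_natSinv_expn_lt (PosNum eD).
apply: (le_trans (H k)); rewrite lerD2l.
have p0 : 0 < (2 : R) ^- k by rewrite invr_gt0 exprn_gt0.
apply: (@le_trans _ _ (D * 2 ^- k)).
  by rewrite ler_pM2r// (le_trans (ler_norm C))// /D lerDl.
by rewrite -ler_pdivlMl// mulrC -[2 ^- k]mul1r ltW.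
Qed.

End OrdinaryDifferentialEquations.

(** * Picard iteration *)

Lemma lipschitz_continuous {R : realType} {V W : normedModType R}
    (f : V -> W) (L : R) :
  (forall x y, `|f x - f y| <= L * `|x - y|) -> continuous f.
Proof.
move=> fL x; apply/cvgrPdist_lt => e e0.
have D0 : 0 < `|L| + 1 by rewrite ltr_wpDl.
near=> z; apply: le_lt_trans (fL _ _) _.
have : `|x - z| < e / (`|L| + 1).
  near: z; apply: cvgr_dist_lt; last by rewrite divr_gt0.
  exact: cvg_id.
rewrite ltr_pdivlMr// => /(le_lt_trans _); apply.
rewrite mulrC ler_wpM2l// (le_trans (ler_norm L))// lerDl.
by [].
Unshelve. all: by end_near. Qed.

Lemma near_norm_lt {R : realType} (r t : R) : `|t| < r ->
  \forall s \near t, `|s| < r.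
Proof. by move=> tr; exact: (cvgr_lt _ (@norm_continuous _ R t)). Qed.

Section Picard.
Context {R : realType} {n : nat}.
Variables (w : 'rV[R]_n -> 'rV[R]_n) (x0 : 'rV[R]_n) (L M delta : R).
Hypotheses (L_ge0 : 0 <= L) (M_ge0 : 0 <= M) (delta_gt0 : 0 < delta).
Hypothesis w_lipschitz : forall x y, `|w x - w y| <= L * `|x - y|.
Hypothesis w_bounded : forall x, `|w x| <= M.
Hypothesis delta_small : delta * L <= 2^-1.
Implicit Types (r s t : R) (u z : R -> 'rV[R]_n).

(** [z] is the Picard iterate of [u]; time is frozen outside the interval
    [- delta, delta], and the primitive is required on a larger open interval so
    that its derivative exists at the endpoints. *)
Definition picard_step u z : Prop :=
  exists P : R -> 'rV[R]_n,
    [/\ P 0 = 0, forall t, `|t| < 2 * delta -> is_derive t 1 P (w (u t)) &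
        forall t, z t = x0 + P (clamp delta t)].

Let clamp_lt t : `|clamp delta t| < 2 * delta.
Proof.
have d := delta_gt0; apply: le_lt_trans (clamp_le _ (ltW d)) _; lra.
Qed.

Lemma picard_step_exists u : continuous u -> exists z, picard_step u z.
Proof.
move=> uc; have [||P [P0 PD]] := @exists_primitive_rV R n (w \o u) (2 * delta).
- by have d := delta_gt0; lra.
- move=> t; apply: continuous_comp; first exact: uc.
  exact: lipschitz_continuous w_lipschitz _.
by exists (fun t => x0 + P (clamp delta t)); exists P.
Qed.

Lemma picard_step_lipschitz u z : picard_step u z ->
  forall s t, `|z s - z t| <= M * `|s - t|.
Proof.
move=> [P [P0 PD zE]] s t; rewrite !zE opprD addrACA subrr add0r.
apply: (@le_trans _ _ (M * `|clamp delta s - clamp delta t|)).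
  apply: (mean_value_sym (T := 2 * delta) M_ge0 PD) => //.
by rewrite ler_wpM2l// clamp_lipschitz.
Qed.

(** The primitive runs over a time at most [delta], so the Lipschitz constant
    gets multiplied by [delta], and [delta * L <= 1/2]. *)
Lemma picard_step_contract u1 u2 z1 z2 C : picard_step u1 z1 ->
  picard_step u2 z2 -> (forall t, `|u1 t - u2 t| <= C) ->
  forall t, `|z1 t - z2 t| <= C / 2.
Proof.
move=> [P1 [P10 PD1 z1E]] [P2 [P20 PD2 z2E]] uC t.
have C0 : 0 <= C := le_trans (normr_ge0 _) (uC 0).
have LC : 0 <= L * C by rewrite mulr_ge0.
rewrite z1E z2E opprD addrACA subrr add0r.
pose D := P1 - P2; have D0 : D 0 = 0 by rewrite /D !fctE P10 P20 subr0.
have DD s : `|s| < 2 * delta -> is_derive s 1 D (w (u1 s) - w (u2 s)).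
  by move=> sd; apply: is_deriveB; [exact: PD1|exact: PD2].
have DL s : `|s| < 2 * delta -> `|w (u1 s) - w (u2 s)| <= L * C.
  by move=> _; rewrite (le_trans (w_lipschitz _ _))// ler_wpM2l.
have d0 : `|0 : R| < 2 * delta by have d := delta_gt0; rewrite normr0; lra.
have := mean_value_sym LC DD DL d0 (clamp_lt t).
rewrite D0 !subr0 => /le_trans; apply.
apply: (@le_trans _ _ (L * C * delta)).
  by rewrite ler_wpM2l// clamp_le// ltW.
have := ler_wpM2r C0 delta_small; lra.
Qed.

Lemma picard_bound u z : picard_step u z -> forall t, `|z t - x0| <= M * delta.
Proof.
move=> uz t; have [P [P0 PD zE]] := uz.
have z0 : z 0 = x0 by rewrite zE clampK ?normr0 ?(ltW delta_gt0)// P0 addr0.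
rewrite zE addrC addKr.
have d0 : `|0 : R| < 2 * delta by have d := delta_gt0; rewrite normr0; lra.
have := mean_value_sym M_ge0 PD (fun t _ => w_bounded (u t)) d0 (clamp_lt t).
rewrite P0 !subr0 => /le_trans; apply.
by rewrite ler_wpM2l// clamp_le// ltW.
Qed.

(** Successive iterates differ by [C / 2 ^ k] by the contraction estimate, hence
    the iterates converge uniformly; the common Lipschitz bound passes to the
    limit. *)
Lemma picard_limit (un : nat -> R -> 'rV[R]_n) :
  un 0%N = cst x0 -> (forall k, picard_step (un k) (un k.+1)) ->
  exists u, (forall s t, `|u s - u t| <= M * `|s - t|) /\
    exists C, forall k t, `|un k t - u t| <= C / 2 ^+ k.
Proof.
move=> un0 unS; pose C := M * delta.
have C0 : 0 <= C by rewrite mulr_ge0// ltW.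
have step k t : `|un k.+1 t - un k t| <= C / 2 ^+ k.
  elim: k t => [|k IH] t.
    by rewrite expr0 divr1 un0; exact: (picard_bound (unS 0%N)).
  have := picard_step_contract (unS k.+1) (unS k) IH t.
  by rewrite exprS invfM -mulrA [_^-1 * 2^-1]mulrC.
(* The geometric tail from [k] to [k + m] is kept exact, for the induction
   on [m]. *)
have tail k m t : `|un (k + m)%N t - un k t| <=
    2 * C / 2 ^+ k - 2 * C / 2 ^+ (k + m).
  elim: m => [|m IH]; first by rewrite addn0 !subrr normr0.
  have := step (k + m)%N t; rewrite addnS => sk.
  rewrite -(subrKA (un (k + m)%N t)); apply: le_trans (ler_normD _ _) _.
  apply: le_trans (lerD sk IH) _.
  by rewrite exprS invfM; move: (_ ^+ _)^-1 (_ ^+ _)^-1 => p q; lra.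
have tail_le k m t : (k <= m)%N -> `|un m t - un k t| <= 2 * C / 2 ^+ k.
  move=> km; have := tail k (m - k)%N t; rewrite subnKC// => /le_trans; apply.
  by rewrite lerBlDr lerDl divr_ge0 ?exprn_ge0// mulr_ge0.
have cvg t : cvgn (fun k => un k t).
  apply/cauchy_cvgP/cauchy_exP => e e0; rewrite /cauchy_ex.
  have D0 : 0 < e / (2 * C + 1) by rewrite divr_gt0//; lra.
  have [k _ /(_ k (leqnn k)) /= kE] := near_infty_natSinv_expn_lt (PosNum D0).
  exists (un k t); exists k => // m /= km.
  rewrite -ball_normE /= distrC; apply: le_lt_trans (tail_le _ _ _ km) _.
  have p0 : 0 < (2 : R) ^- k by rewrite invr_gt0 exprn_gt0.
  move: kE; rewrite ltr_pdivlMr; last by lra.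
  by apply: le_lt_trans; rewrite mul1r mulrC ler_wpM2l ?(ltW p0)//; lra.
pose u t := limn (fun k => un k t).
have uk k t : `|un k t - u t| <= 2 * C / 2 ^+ k.
  apply/ler_addgt0Pr => e e0.
  have /cvgrPdist_le /(_ _ e0) [m _ mE] := cvg t.
  pose p := maxn k m.
  rewrite -(subrKA (un p t)) addrC; apply: le_trans (ler_normD _ _) _.
  rewrite addrC; apply: lerD; first by rewrite distrC tail_le// leq_maxl.
  by rewrite distrC; apply: mE => /=; rewrite leq_maxr.
exists u; split; last by exists (2 * C).
move=> s t; apply: (@le_geometric _ _ _ (2 * C)) => k.
have k1 := uk k.+1 s; have k2 := uk k.+1 t.
have k3 := picard_step_lipschitz (unS k) s t.
rewrite (_ : u s - u t =
  (un k.+1 s - un k.+1 t) - (un k.+1 s - u s) + (un k.+1 t - u t)).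
  apply: le_trans (ler_normD _ _) _.
  apply: le_trans (lerD (ler_normB _ _) (lexx _)) _.
  move: k1 k2; rewrite exprS invfM; move: (_ ^+ _)^-1 => p.
  by move: `|_| `|_| k3 => a b k3 *; lra.
by rewrite opprB [X in _ = X + _]addrC subrKA subrKA.
Qed.

(** The Picard iterate of the limit is as close to the limit as one wants, hence
    equal to it. *)
Lemma picard_solution : exists u,
  [/\ u 0 = x0, forall t, `|u t - x0| <= M * `|t| &
      forall t, `|t| < delta -> is_derive t 1 u (w (u t))].
Proof.
have /choice[step stepP] u : exists z, continuous u -> picard_step u z.
  have [/picard_step_exists[z uz]|nc] := pselect (continuous u).
    by exists z.
  by exists u.
pose un k := iter k step (cst x0).
have unc k : continuous (un k).
  elim: k => [|k /stepP H]; first by move=> t; exact: cst_continuous.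
  exact: lipschitz_continuous (picard_step_lipschitz H).
have unS k : picard_step (un k) (un k.+1) := stepP _ (unc k).
have [u [uL [C uC]]] := picard_limit erefl unS.
have [z uz] := picard_step_exists (lipschitz_continuous uL).
have zu t : z t = u t.
  apply/eqP; rewrite -subr_eq0 -normr_le0.
  apply: (@le_geometric _ _ _ (2 * C)) => k.
  have h1 := picard_step_contract (unS k) uz (uC k) t.
  have h2 := uC k.+1 t.
  rewrite add0r -(subrKA (un k.+1 t)); apply: le_trans (ler_normD _ _) _.
  rewrite distrC; apply: le_trans (lerD h1 h2) _.
  have C0 : 0 <= C by have := le_trans (normr_ge0 _) (uC 0%N 0); rewrite divr1.
  have p0 : 0 < (2 : R) ^- k by rewrite invr_gt0 exprn_gt0.
  rewrite exprS invfM; move: (_ ^+ _)^-1 p0 => p p0.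
  have := mulr_ge0 C0 (ltW p0); lra.
have [P [P0 PD zE]] := uz.
exists u; split.
- by rewrite -zu zE clampK ?normr0 ?(ltW delta_gt0)// P0 addr0.
- move=> t; have -> : x0 = u 0.
    by rewrite -zu zE clampK ?normr0 ?(ltW delta_gt0)// P0 addr0.
  by rewrite -[in leRHS](subr0 t); exact: uL.
- move=> t td.
  have tP : is_derive t 1 (cst x0 + P) (w (u t)).
    rewrite -[w _]add0r; apply: is_deriveD; apply: PD.
    by have d := delta_gt0; lra.
  apply: near_eq_is_derive tP.
  near=> s; rewrite -zu zE clampK// ltW//.
  by near: s; exact: near_norm_lt.
Unshelve. all: by end_near. Qed.

End Picard.

(** * Local flows *)

Section LocalFlow.
Context {R : realType} {n : nat}.
Implicit Types (r s t : R) (u z : R -> 'rV[R]_n) (x y : 'rV[R]_n).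

(** Near [x0] the partial derivatives are bounded, and the mean value theorem on
    segments of a ball turns this into a Lipschitz bound. *)
Lemma C1_locally_lipschitz (v : 'rV[R]_n -> 'rV[R]_n) (U : set 'rV[R]_n) x0 :
  open U -> U x0 -> Ck_on 1 U v ->
  exists r (L : R), [/\ 0 < r, 0 <= L, forall x, `|x - x0| <= r -> U x &
    forall x y, `|x - x0| <= r -> `|y - x0| <= r ->
      `|v x - v y| <= L * `|x - y|].
Proof.
move=> oU Ux0 [vd vc].
pose K i := `|'D_(delta_mx 0 i) v x0| + 1.
have near_bound : \forall x \near x0, U x /\
    forall i, `|'D_(delta_mx 0 i) v x| < K i.
  near=> x; split; first by near: x; exact: open_nbhs_nbhs.
  near: x; apply: filter_forall => /= i.
  have Dc : {for x0, continuous (fun x => `|'D_(delta_mx 0 i) v x|)}.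
    apply: continuous_comp; first exact: vc.
    exact: norm_continuous.
  by apply: (cvgr_lt _ Dc); rewrite /K ltrDl.
have /nbhs_ballP[e /= e0 eB] := near_bound.
pose L := \sum_i K i.
have L0 : 0 <= L by apply: sumr_ge0 => i _; rewrite addr_ge0.
have inB x : `|x - x0| <= e / 2 -> ball x0 e x.
  rewrite -ball_normE /= distrC => /le_lt_trans; apply.
  by rewrite ltr_pdivrMr// ltr_pMr// ltr1n.
exists (e / 2), L; split=> //; first by rewrite divr_gt0.
  by move=> x /inB /eB [].
move=> x y xB yB.
pose p t := t *: (x - y) + y.
have pB t : 0 <= t <= 1 -> `|p t - x0| <= e / 2.
  move=> /andP[t0 t1].
  rewrite (_ : p t - x0 = t *: (x - x0) + (1 - t) *: (y - x0)).
    apply: le_trans (ler_normD _ _) _; rewrite !normrZ.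
    rewrite (ger0_norm t0) [`|1 - t|]ger0_norm ?subr_ge0//.
    have := ler_wpM2l t0 xB; have : 0 <= 1 - t by rewrite subr_ge0.
    move=> t1'; have := ler_wpM2l t1' yB; lra.
  by apply/rowP => i; rewrite !mxE; ring.
have pd t : is_derive t 1 p (x - y).
  rewrite -[x - y]addr0; apply: is_deriveD.
  have := is_diff_scalel t (x - y) => H.
  split; first exact/derivable1_diffP.
  by rewrite deriveE// diff_val scale1r.
have vp t : 0 <= t <= 1 -> is_derive t 1 (v \o p) ('D_(x - y) v (p t)).
  move=> /pB /inB /eB[Up _]; have [pt pE] := pd t.
  have pt' : differentiable p t by apply/derivable1_diffP.
  split; last by rewrite derive_comp ?pE//; exact: vd.
  by apply/derivable1_diffP; apply: differentiable_comp => //; exact: vd.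
have vL t : 0 <= t <= 1 -> `|'D_(x - y) v (p t)| <= L * `|x - y|.
  move=> /pB /inB /eB[Up pK]; rewrite derive_row; last exact: vd.
  apply: le_trans (ler_norm_sum _ _ _) _; rewrite mulr_suml.
  apply: ler_sum => i _; rewrite normrZ mulrC ler_pM//.
    exact/ltW/pK.
  exact: rV_coord_le.
have := mean_value_le ler01 _ vp vL.
rewrite /= /p scale1r scale0r subrK add0r subr0 mulr1; apply.
by rewrite mulr_ge0.
Unshelve. all: by end_near. Qed.

(** For the supremum norm, clamping the coordinates is a 1-Lipschitz retraction
    onto the closed ball; composing with it makes a locally Lipschitz field
    globally Lipschitz and bounded. *)
Definition box_retraction x0 r x : 'rV[R]_n :=
  \row_i (x0 0 i + clamp r (x 0 i - x0 0 i)).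

Lemma box_retraction_le x0 r x : 0 <= r -> `|box_retraction x0 r x - x0| <= r.
Proof.
move=> r0; apply: rV_norm_le => // i.
by rewrite !mxE addrC addKr clamp_le.
Qed.

Lemma box_retractionK x0 r x : `|x - x0| <= r -> box_retraction x0 r x = x.
Proof.
move=> xr; apply/rowP => i; rewrite !mxE clampK; first by rewrite addrC subrK.
by have := rV_coord_le (x - x0) i; rewrite !mxE => /le_trans; apply.
Qed.

Lemma box_retraction_lipschitz x0 r x y :
  `|box_retraction x0 r x - box_retraction x0 r y| <= `|x - y|.
Proof.
apply: rV_norm_le => // i; rewrite !mxE opprD addrACA subrr add0r.
apply: le_trans (clamp_lipschitz _ _ _) _.
rewrite opprB subrKA.
by have := rV_coord_le (x - y) i; rewrite !mxE.
Qed.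

(** The field composed with the retraction has a solution, and for small times
    that solution does not leave the ball where nothing was changed. *)
Lemma local_flow_exists (v : 'rV[R]_n -> 'rV[R]_n) x0 r L : 0 < r -> 0 <= L ->
  (forall x y, `|x - x0| <= r -> `|y - x0| <= r ->
     `|v x - v y| <= L * `|x - y|) ->
  exists (delta : R) u, [/\ 0 < delta, u 0 = x0,
    forall t, `|t| < delta -> `|u t - x0| <= r &
    forall t, `|t| < delta -> is_derive t 1 u (v (u t))].
Proof.
move=> r0 L0 vL; pose M := `|v x0| + L * r.
have M0 : 0 <= M by rewrite addr_ge0// mulr_ge0// ltW.
pose w := v \o box_retraction x0 r.
have bB x : `|box_retraction x0 r x - x0| <= r.
  by apply: box_retraction_le; exact: ltW.
have wL x y : `|w x - w y| <= L * `|x - y|.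
  apply: le_trans (vL _ _ _ _) _ => //.
  by rewrite ler_wpM2l// box_retraction_lipschitz.
have x0B : `|x0 - x0| <= r by rewrite subrr normr0 ltW.
have wM x : `|w x| <= M.
  rewrite -(subrK (v x0) (w x)) addrC; apply: le_trans (ler_normD _ _) _.
  rewrite lerD2l; apply: le_trans (vL _ _ _ _) _ => //.
  by rewrite ler_wpM2l.
(* With [delta = D^-1] the solution is contracted by 1/2 and moves by at most
   [r]. *)
pose D := 2 * L + M / r + 1.
have Mr0 : 0 <= M / r by rewrite divr_ge0// ltW.
have D0 : 0 < D by rewrite /D; lra.
have dL : D^-1 * L <= 2^-1 by rewrite mulrC ler_pdivrMr// /D; lra.
have dM : M * D^-1 <= r.
  by rewrite ler_pdivrMr// -ler_pdivrMl// mulrC /D; lra.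
have Di0 : 0 < D^-1 by rewrite invr_gt0.
have [u [u0 uM uw]] := picard_solution x0 L0 M0 Di0 wL wM dL.
have uB t : `|t| < D^-1 -> `|u t - x0| <= r.
  move=> tD; apply: le_trans (uM t) _; apply: le_trans dM.
  by rewrite ler_wpM2l// ltW.
exists D^-1, u; split=> // t tD.
by have := uw t tD; rewrite /w /= box_retractionK// uB.
Qed.

(** Integrating a bound [C / 2 ^ k] on the difference over a time at most
    [delta] halves it. *)
Lemma local_flow_unique (v : 'rV[R]_n -> 'rV[R]_n) (B : set 'rV[R]_n)
    (L C delta : R) u z :
  0 <= L -> delta * L <= 2^-1 ->
  (forall x y, B x -> B y -> `|v x - v y| <= L * `|x - y|) ->
  (forall x y, B x -> B y -> `|x - y| <= C) ->
  (forall t, `|t| < delta -> B (u t) /\ is_derive t 1 u (v (u t))) ->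
  (forall t, `|t| < delta -> B (z t) /\ is_derive t 1 z (v (z t))) ->
  u 0 = z 0 ->
  forall t, `|t| < delta -> u t = z t.
Proof.
move=> L0 dL vL BC uv zv uz0 t td.
have d0 : 0 < delta := le_lt_trans (normr_ge0 t) td.
have close k s : `|s| < delta -> `|u s - z s| <= C / 2 ^+ k.
  elim: k s => [|k IH] s sd.
    by rewrite divr1; apply: BC; [exact: (uv s sd).1|exact: (zv s sd).1].
  have C0 : 0 <= C / 2 ^+ k := le_trans (normr_ge0 _) (IH s sd).
  have DD r : `|r| < delta -> is_derive r 1 (u - z) (v (u r) - v (z r)).
    by move=> rd; apply: is_deriveB; [exact: (uv r rd).2|exact: (zv r rd).2].
  have DL r : `|r| < delta -> `|v (u r) - v (z r)| <= L * (C / 2 ^+ k).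
    move=> rd; apply: le_trans (vL _ _ (uv r rd).1 (zv r rd).1) _.
    by rewrite ler_wpM2l// IH.
  have n0 : `|0 : R| < delta by rewrite normr0.
  have := mean_value_sym (mulr_ge0 L0 C0) DD DL n0 sd.
  rewrite !fctE uz0 subrr !subr0 => /le_trans; apply.
  apply: (@le_trans _ _ (L * (C / 2 ^+ k) * delta)).
    by apply: ler_wpM2l; [exact: mulr_ge0|exact: ltW].
  rewrite exprS invfM; have := ler_wpM2r C0 dL.
  by move: (_ ^+ _)^-1 => p; lra.
apply/eqP; rewrite -subr_eq0 -normr_le0; apply: (@le_geometric _ _ _ C) => k.
by rewrite add0r; exact: close.
Qed.

End LocalFlow.

(** * Smoothness of integral curves *)

Section Smoothness.
Context {R : realType}.

(** The differential of [f] also serves for [g], the remainder estimate being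
    local. *)
Lemma near_eq_differentiable {V W : normedModType R} (f g : V -> W) x :
  {near x, f =1 g} -> differentiable f x -> differentiable g x.
Proof.
move=> fg fd; have fgx : f x = g x := nbhs_singleton fg.
have dfc : continuous ('d f x) := diff_continuous fd.
apply/diffP; apply: (@getPex _ (fun df : {linear V -> W} => continuous df /\
  forall y, g y = g (lim (nbhs x)) + df (y - lim (nbhs x))
                  +o_(y \near x) (y - lim (nbhs x)))).
exists ('d f x); split=> //.
suff : g = cst (g (lim (nbhs x))) + 'd f x \o center (lim (nbhs x))
    +o_x (center (lim (nbhs x))) by rewrite funeqE.
have [[_ /eqaddoP fE]] := fd.
apply/eqaddoP => e e0; have := fE e e0.
rewrite lim_id//; apply: filterS2 fg => y fgy; rewrite !fctE /= fgy fgx.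
by [].
Qed.

Lemma Ck_on_eq {V W : normedModType R} k (U : set V) (f g : V -> W) :
  open U -> (forall x, U x -> f x = g x) -> Ck_on k U f -> Ck_on k U g.
Proof.
move=> oU; elim: k f g => [|k IH] f g fg /=.
  move=> fc x Ux; change (g z @[z --> x] --> g x); rewrite -(fg x Ux).
  apply: cvg_trans (fc x Ux); apply: near_eq_cvg; near=> z.
  by apply: fg; near: z; exact: open_nbhs_nbhs.
move=> [fd fD]; split=> [x Ux|v].
  apply: near_eq_differentiable (fd x Ux).
  by near=> z; apply: fg; near: z; exact: open_nbhs_nbhs.
apply: IH (fD v) => x Ux; apply: near_eq_derive.
by near=> z; apply: fg; near: z; exact: open_nbhs_nbhs.
Unshelve. all: by end_near. Qed.

Lemma Ck_onW {V W : normedModType R} k (U : set V) (f : V -> W) :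
  Ck_on k.+1 U f -> Ck_on k U f.
Proof.
elim: k f => [|k IH] f [fd fD].
  by move=> x /fd; exact: differentiable_continuous.
by split=> // v; apply: IH; exact: fD.
Qed.

Lemma Ck_on_coord {V : normedModType R} n k (U : set V) (f : V -> 'rV[R]_n) i :
  open U -> Ck_on k U f -> Ck_on k U (fun x => f x 0 i).
Proof.
move=> oU; elim: k f => [|k IH] f /=.
  move=> fc x Ux; apply: (@continuous_comp _ _ _ f (fun M : 'rV[R]_n => M 0 i)).
    exact: fc.
  exact: matrix_normedtype.coord_continuous.
move=> [fd fD]; split=> [x Ux|v].
  apply: (@differentiable_comp _ _ _ _ f (fun M : 'rV[R]_n => M 0 i)).
    exact: fd.
  exact: differentiable_coord.
apply: Ck_on_eq (IH _ (fD v)) => // x Ux; apply/esym/derive_val.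
by apply: (is_derive_mxP _ _ _ _).1; apply/derivableP/diff_derivable/fd.
Qed.

Lemma Ck_on_cst {V W : normedModType R} k (U : set V) (a : W) :
  open U -> Ck_on k U (cst a).
Proof.
move=> oU; elim: k a => [|k IH] a /=.
  by move=> x _; exact: cst_continuous.
split=> [x _|v]; first exact: differentiable_cst.
by apply: Ck_on_eq (IH 0) => // x _; rewrite derive_cst.
Qed.

Lemma Ck_on_id {V : normedModType R} k (U : set V) :
  open U -> Ck_on k U (@id V).
Proof.
move=> oU; case: k => [|k] /=; first by move=> x _; exact: cvg_id.
split=> // v; apply: Ck_on_eq (Ck_on_cst k v oU) => // x _.
by rewrite derive_id.
Qed.

Lemma Ck_onD {V W : normedModType R} k (U : set V) (f g : V -> W) :
  open U -> Ck_on k U f -> Ck_on k U g -> Ck_on k U (f + g).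
Proof.
move=> oU; elim: k f g => [|k IH] f g /=.
  by move=> fc gc x Ux; apply: continuousD; [exact: fc|exact: gc].
move=> [fd fD] [gd gD]; split=> [x Ux|v].
  by apply: differentiableD; [exact: fd|exact: gd].
apply: Ck_on_eq (IH _ _ (fD v) (gD v)) => // x Ux.
by rewrite deriveD//; apply: diff_derivable; [exact: fd|exact: gd].
Qed.

Lemma Ck_onZ {V W : normedModType R} k (U : set V) (r : R) (f : V -> W) :
  open U -> Ck_on k U f -> Ck_on k U (r *: f).
Proof.
move=> oU; elim: k f => [|k IH] f /=.
  by move=> fc x Ux; apply: continuousZl_tmp; exact: fc.
move=> [fd fD]; split=> [x Ux|v]; first by apply: differentiableZ; exact: fd.
apply: Ck_on_eq (IH _ (fD v)) => // x Ux.
by rewrite deriveZ//; apply: diff_derivable; exact: fd.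
Qed.

Lemma Ck_on_sum {V W : normedModType R} k (U : set V) n (f : 'I_n -> V -> W) :
  open U -> (forall i, Ck_on k U (f i)) -> Ck_on k U (\sum_i f i).
Proof.
move=> oU fC; apply: big_ind => //; first exact: Ck_on_cst.
by move=> g h; exact: Ck_onD.
Qed.

Lemma Ck_onM {V : normedModType R} k (U : set V) (f g : V -> R) :
  open U -> Ck_on k U f -> Ck_on k U g -> Ck_on k U (f * g).
Proof.
move=> oU; elim: k f g => [|k IH] f g.
  by move=> fc gc x Ux; apply: continuousM; [exact: fc|exact: gc].
move=> fC gC; have [fd fD] := fC; have [gd gD] := gC.
split=> [x Ux|v]; first by apply: differentiableM; [exact: fd|exact: gd].
have H := Ck_onD oU (IH _ _ (Ck_onW fC) (gD v)) (IH _ _ (Ck_onW gC) (fD v)).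
apply: Ck_on_eq H => // x Ux.
by rewrite deriveM//; apply: diff_derivable; [exact: fd|exact: gd].
Qed.

Lemma Ck_on_rV n k (T : set R) (f : R -> 'rV[R]_n) :
  open T -> (forall i, Ck_on k T (fun t => f t 0 i)) -> Ck_on k T f.
Proof.
move=> oT; elim: k f => [|k IH] f fC.
  move=> t Tt; apply/cvgrPdist_le => e e0; near=> s.
  apply: rV_norm_le => [|i]; first exact: ltW.
  rewrite !mxE; move: i; near: s; apply: filter_forall => i.
  by have /cvgrPdist_le := fC i t Tt; apply.
have fd t : T t -> derivable f t 1.
  move=> Tt; apply/derivable_mxP => j i; rewrite ord1.
  by have [+ _] := fC i => /(_ t Tt)/derivable1_diffP.
split=> [t /fd|v]; first by move/derivable1_diffP.
apply: IH => i; have [_ /(_ v)] := fC i; apply: Ck_on_eq => // t Tt.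
apply: derive_val.
have /derivable1_diffP/(@diff_derivable _ _ _ _ _ v) := fd t Tt.
by move=> /derivableP/is_derive_mxP.
Unshelve. all: by end_near. Qed.

(** The derivative of [W (x t)] is [DW (x t)] with [DW] the derivative of [W]
    along [V]; as [DW] is again smooth, induction on [k] applies for all [W] at
    once. *)
Lemma Ck_on_integral_curve n (U : set 'rV[R]_n) (T : set R)
    (V : 'rV[R]_n -> 'rV[R]_n) (x : R -> 'rV[R]_n) (W : 'rV[R]_n -> R) k :
  open U -> open T -> (forall t, T t -> U (x t)) ->
  (forall t, T t -> is_derive t 1 x (V (x t))) ->
  smooth_on U V -> smooth_on U W -> Ck_on k T (W \o x).
Proof.
move=> oU oT TU xV Vs; elim: k W => [|k IH] W Ws.
  move=> t Tt; apply: continuous_comp; last exact: Ws 0%N _ (TU t Tt).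
  apply: differentiable_continuous; apply/derivable1_diffP.
  by case: (xV t Tt).
have Wd t : T t -> differentiable W (x t).
  by move=> /TU; have [Wd _] := Ws 1%N; exact: Wd.
have xd t : T t -> differentiable x t.
  by move=> /xV[xd _]; apply/derivable1_diffP.
split=> [t Tt|r]; first by apply: differentiable_comp; [exact: xd|exact: Wd].
pose DW := \sum_i (fun z => V z 0 i) * ('D_(delta_mx 0 i) W).
have DWs : smooth_on U DW.
  move=> j; apply: Ck_on_sum => // i; apply: Ck_onM => //.
    exact/Ck_on_coord/Vs.
  by have [_] := Ws j.+1; apply.
have H := Ck_onM oT (Ck_on_cst k r oT) (IH _ DWs).
apply: Ck_on_eq H => // t Tt.
have [_ x'] := xV t Tt.
have -> : r = r *: (1 : R) by rewrite /GRing.scale/= mulr1.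
have xd' := xd t Tt; have Wd' := Wd t Tt.
rewrite deriveZdir; last exact: differentiable_comp.
rewrite derive_comp// x' derive_row// /DW !fctE fct_sumE.
by rewrite [_ *: 1]mulr1.
Qed.

End Smoothness.

(** * One-parameter subgroups *)

(** Put [f t = gam (t / 2 ^ N) ^ (2 ^ N)]: the value does not depend on [N] once
    [t / 2 ^ N] is small, so that finitely many times can use the same [N].
    Small values of [gam] commute, since addition of times does. *)
Lemma local_hom_extension {R : realType} {T : groupType} (gam : R -> T)
    (delta : R) : 0 < delta ->
  (forall s t, `|s| < delta -> `|t| < delta ->
     gam (s + t) = (gam s * gam t)%g) ->
  exists2 f : R -> T, (forall s t, f (s + t) = (f s * f t)%g) &
    forall t, `|t| < delta -> f t = gam t.
Proof.
move=> d0 gamD.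
pose Phi (N : nat) (t : R) := let g := gam (t / 2 ^+ N) in (g ^+ (2 ^ N)%N)%g.
have small_half N t : `|t / 2 ^+ N| < delta -> `|t / 2 ^+ N.+1| < delta.
  apply: le_lt_trans; rewrite exprS invfM mulrCA normrM ger0_norm//.
  by rewrite ler_piMl// invf_le1// ler1n.
have PhiS N t : `|t / 2 ^+ N| < delta -> Phi N.+1 t = Phi N t.
  move=> /small_half tN; rewrite /Phi /= expnS expgnA expg2 -gamD//.
  have p0 : (2 : R) ^+ N != 0 by rewrite expf_neq0.
  by congr ((gam _ ^+ _)%g); rewrite exprS; field.
have small_le N t m : (N <= m)%N -> `|t / 2 ^+ N| < delta ->
    `|t / 2 ^+ m| < delta /\ Phi m t = Phi N t.
  move=> /subnK <-; move: (m - N)%N => k tN.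
  elim: k => [|k [IH1 IH2]]; first by rewrite add0n.
  by rewrite addSn; split; [exact: small_half|rewrite PhiS].
have small_exists t : exists N : nat, `|t / 2 ^+ N| < delta.
  (* The [1] keeps the quotient meaningful at [t = 0]. *)
  have e0 : 0 < delta / (`|t| + 1) by rewrite divr_gt0// ltr_wpDl.
  have [k _ /(_ k (leqnn k)) /= kE] := near_infty_natSinv_expn_lt (PosNum e0).
  exists k; rewrite normrM normfV [`|2 ^+ k|]ger0_norm ?exprn_ge0//.
  have p0 : 0 < (2 : R) ^- k by rewrite invr_gt0 exprn_gt0.
  move: kE; rewrite ltr_pdivlMr ?ltr_wpDl// div1r mulrC; apply: le_lt_trans.
  by rewrite ler_wpM2r ?lerDl// ltW.
have /choice[N NP] := small_exists.
exists (fun t => Phi (N t) t); last first.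
  move=> t td; have t0 : `|t / 2 ^+ 0| < delta by rewrite expr0 divr1.
  have [_ ->] := small_le _ _ _ (leq0n (N t)) t0.
  by rewrite /Phi /= expr0 divr1.
move=> s t; pose m := maxn (maxn (N s) (N t)) (N (s + t)).
have [sm <-] := small_le _ s m (leq_trans (leq_maxl _ _) (leq_maxl _ _)) (NP s).
have [tm <-] := small_le _ t m (leq_trans (leq_maxr _ _) (leq_maxl _ _)) (NP t).
have [_ <-] := small_le _ (s + t) m (leq_maxr _ _) (NP (s + t)).
rewrite /Phi /= mulrDl gamD// expgMn//.
by rewrite /commute -!gamD// addrC.
Qed.

Section OneParameterSubgroup.
Context {R : realType} {n : nat} {G : lieGroup R n}.
Variables (Y : vfield G) (Y_inv : left_invariant Y).
Implicit Types (s t : R) (x y : 'rV[R]_n).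

(** For fixed [s] both [gam (s + t)] and [gam s * gam t] are integral curves of
    [Y] that start at [gam s], hence they agree. *)
Lemma one_parameter_germ (c : chart R n G) : atlas c -> dom c 1%g ->
  exists (delta : R) (gam : R -> G), [/\ 0 < delta, gam 0 = 1%g,
    forall t, `|t| < delta -> dom c (gam t) /\
      is_derive t 1 (coord c \o gam) (Y c (coord c (gam t))),
    forall t, `|t| < delta -> {for t, continuous gam} &
    forall s t, `|s| < delta -> `|t| < delta ->
      gam (s + t) = (gam s * gam t)%g].
Proof.
move=> ca c1; have cx := coord_cod c1.
have YC1 : Ck_on 1 (cod c) (Y c) by have [[Ys _] _] := Y_inv; exact: Ys.
have [r [L [r0 L0 rU YL]]] := C1_locally_lipschitz (open_cod (c:=c)) cx YC1.
have [d1 [u [d10 u0 uB uY]]] := local_flow_exists r0 L0 YL.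
pose gam t := pt c (u t).
have gdom t : `|t| < d1 -> dom c (gam t).
  by move=> /uB/rU; exact: pt_dom.
have cgam t : `|t| < d1 -> coord c (gam t) = u t.
  by move=> /uB/rU; exact: ptK.
have gam0 : gam 0 = 1%g by rewrite /gam u0 coordK.
have gderive t : `|t| < d1 ->
    is_derive t 1 (coord c \o gam) (Y c (coord c (gam t))).
  move=> td; rewrite cgam//; apply: near_eq_is_derive (uY t td).
  near=> s; rewrite /= cgam//; near: s; exact: near_norm_lt.
have gcont t : `|t| < d1 -> {for t, continuous gam}.
  move=> td; apply: continuous_comp; last by apply: pt_continuous; apply/rU/uB.
  apply: differentiable_continuous; apply/derivable1_diffP.
  by case: (uY t td).
have d10' : `|0 : R| < d1 by rewrite normr0.
have near1 : \forall p \near (1%g : G),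
    dom c p /\ `|coord c p - coord c 1%g| <= r.
  near=> p; split.
    by near: p; apply: open_nbhs_nbhs; split=> //; exact: open_dom.
  rewrite distrC; near: p.
  have /cvgrPdist_le := coord_continuous c1; apply; exact: r0.
have mul0 : (fun p : R * R => (gam p.1 * gam p.2)%g) @ ((0 : R), (0 : R))
    --> (gam 0 * gam 0)%g.
  change ({for ((0 : R), (0 : R)), continuous
    ((fun q : G * G => (q.1 * q.2)%g) \o
     (fun p : R * R => (gam p.1, gam p.2)))}).
  apply: continuous_comp; last exact: mul_continuous.
  apply: cvg_pair.
    apply: (@continuous_comp _ _ _ (@fst R R) gam); first exact: cvg_fst.
    exact: gcont.
  apply: (@continuous_comp _ _ _ (@snd R R) gam); first exact: cvg_snd.
  exact: gcont.
rewrite gam0 mulg1 in mul0.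
have /nbhs_ballP[d2 /= d20 d2E] := mul0 _ near1.
have gmul s t : `|s| < d2 -> `|t| < d2 -> dom c (gam s * gam t)%g /\
    `|coord c (gam s * gam t)%g - coord c 1%g| <= r.
  move=> sd td; apply: (d2E (s, t)).
  by split; rewrite -ball_normE /= sub0r normrN.
(* [d3] makes the Lipschitz estimate contract, [d2] keeps the products in the
   ball, and half of [d1] leaves room for sums of two times. *)
pose d3 := (2 * L + 2)^-1.
have d30 : 0 < d3 by rewrite invr_gt0; lra.
have d3L : d3 * L <= 2^-1 by rewrite mulrC ler_pdivrMr; lra.
pose delta := Num.min (d1 / 2) (Num.min d2 d3).
have delta0 : 0 < delta by rewrite !lt_min divr_gt0//= d20 d30.
have lt_delta t : `|t| < delta -> [/\ `|t| < d1 / 2, `|t| < d2 & `|t| < d3].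
  by rewrite !lt_min => /and3P.
have half1 t : `|t| < d1 / 2 -> `|t| < d1.
  by move=> td; apply: lt_le_trans td _; have := d10; lra.
have gamD s t : `|s| < delta -> `|t| < delta ->
    gam (s + t) = (gam s * gam t)%g.
  move=> sd td.
  have [s1 s2 s3] := lt_delta s sd; have [t1 t2 t3] := lt_delta t td.
  have sum_lt (x : R) : `|x| < delta -> `|s + x| < d1.
    move=> /lt_delta[x1 _ _]; apply: le_lt_trans (ler_normD _ _) _.
    by apply: lt_le_trans (ltrD s1 x1) _; rewrite -splitr.
  have st1 := sum_lt t td.
  suff E : u (s + t) = coord c (gam s * gam t)%g.
    by rewrite -[RHS](coordK (gmul s t s2 t2).1) -E.
  pose B := [set x | `|x - coord c 1%g| <= r].
  apply: (@local_flow_unique _ _ (Y c) B L (2 * r) delta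
    (fun t => u (s + t)) (fun t => coord c (gam s * gam t)%g)) => //.
  - rewrite (le_trans _ d3L)// ler_wpM2r// /delta.
    by rewrite !ge_min lexx !orbT.
  - move=> x y xB yB; rewrite -(subrKA (coord c 1%g)).
    apply: le_trans (ler_normD _ _) _; rewrite [X in _ + X]distrC.
    by apply: le_trans (lerD xB yB) _; lra.
  - move=> x xd; split; first exact/uB/sum_lt.
    have [ud uE] := uY _ (sum_lt x xd).
    have ud' : differentiable u (s + x) by apply/derivable1_diffP.
    have sd' : is_derive x 1 (fun t => s + t) 1.
      by rewrite -[X in is_derive _ _ _ X]add0r; apply: is_deriveD.
    have sd'' : differentiable (fun t => s + t) x.
      by apply/derivable1_diffP; case: sd'.
    split; first by apply/derivable1_diffP; exact: differentiable_comp sd'' ud'.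
    rewrite (derive_comp _ sd'' ud').
    by rewrite (@derive_val _ _ _ _ _ _ _ sd').
  - move=> x xd; have [x1 x2 x3] := lt_delta x xd.
    split; first exact: (gmul s x s2 x2).2.
    apply: (is_derive_ltranslation Y_inv ca ca).
    + exact/gcont/half1.
    + exact/gdom/half1.
    + exact: (gmul s x s2 x2).1.
    + exact/gderive/half1.
  - by rewrite addr0 gam0 mulg1 cgam// half1.
exists delta, gam; split=> // t /lt_delta[/half1 t1 _ _].
  by split; [exact: gdom|exact: gderive].
exact: gcont.
Unshelve. all: by end_near. Qed.

Lemma exp_curve_exists : exists gam : R -> G, exp_curve Y gam.
Proof.
have [c ca c1] := @atlas_cover R n G 1%g.
have [delta [g [d0 g0 gY gc gD]]] := one_parameter_germ ca c1.
have [f fD fg] := local_hom_extension d0 gD.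
have f0 : f 0 = 1%g := hom_one fD.
have n0 : `|0 : R| < delta by rewrite normr0.
have near_fg : {near (0 : R), f =1 g}.
  by near=> t; apply: fg; near: t; exact: near_norm_lt.
have fc0 : {for 0, continuous f}.
  change (f t @[t --> 0] --> f 0); rewrite fg//.
  apply: cvg_trans (gc 0 n0); apply: near_eq_cvg.
  by near=> t; apply/esym; near: t; exact: near_fg.
have fc : continuous f.
  move=> t; have -> : f = (fun h => f t * f h)%g \o (fun s => s - t).
    by apply/funext => s /=; rewrite -fD addrC subrK.
  apply: continuous_comp.
    by apply: continuousB; [exact: cvg_id|exact: cst_continuous].
  rewrite subrr.
  change ({for (0 : R), continuous
    ((fun q : G * G => (q.1 * q.2)%g) \o (fun h => (f t, f h)))}).
  apply: continuous_comp; last exact: mul_continuous.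
  by apply: cvg_pair; [exact: cvg_cst|exact: fc0].
have f'0 : is_derive (0 : R) 1 (coord c \o f) (Y c (coord c (f 0))).
  have [_] := gY 0 n0; rewrite -(fg 0 n0); apply: near_eq_is_derive.
  by near=> t; rewrite /=; congr coord; apply/esym; near: t; exact: near_fg.
have f0c : dom c (f 0) by rewrite f0.
have f' d t : atlas d -> dom d (f t) ->
    is_derive t 1 (coord d \o f) (Y d (coord d (f t))).
  by move=> da dt; exact: (is_derive_one_parameter Y_inv ca da fc0 fD f0c dt).
exists f; split=> //; last first.
  move=> d da d1; rewrite derive1E -f0; apply: derive_val.
  by apply: f' => //; rewrite f0.
split=> // d da k.
have oT : open (f @^-1` dom d).
  by apply: open_comp => [t _|]; [exact: fc|exact: open_dom].
apply: Ck_on_rV => // i.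
have [[Ys _] _] := Y_inv.
apply: (@Ck_on_integral_curve _ _ (cod d) _ (Y d) (coord d \o f)
  (fun x => x 0 i)) => //.
- exact: open_cod.
- by move=> t; exact: coord_cod.
- by move=> t dt; exact: f'.
- exact: Ys.
- move=> j; have oC := open_cod (c:=d).
  exact: (Ck_on_coord i oC (Ck_on_id j oC)).
Unshelve. all: by end_near. Qed.

End OneParameterSubgroup.

(** * Left invariant fields and geodesic vectors *)

Section LeftInvariantFields.
Context {R : realType} {n : nat} {G : lieGroup R n}.
Implicit Types (c d : chart R n G) (X Y : vfield G).

Lemma transition_differentiable c d x : atlas c -> atlas d ->
  overlap c d x -> differentiable (transition c d) x.
Proof.
move=> ca da; have [_ comp _] := atlas_maximal G.
by have [/(_ 1%N)[td _] _] := comp c d ca da; exact: td.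
Qed.

Lemma left_invariant_eq X Y : vf_eq X Y -> left_invariant Y -> left_invariant X.
Proof.
move=> XY [[Ys Yt] Yl]; split; [split|].
- move=> c ca k; apply: Ck_on_eq (Ys c ca k); first exact: open_cod.
  by move=> x cx; rewrite XY.
- move=> c d ca da x [cx dx]; rewrite !XY//; first exact: Yt.
  exact: coord_cod.
- move=> g c d ca da x [cx dx]; rewrite !XY//; first exact: Yl.
  exact: coord_cod.
Qed.

Lemma left_invariantD X Y :
  left_invariant X -> left_invariant Y -> left_invariant (X + Y).
Proof.
move=> [[Xs Xt] Xl] [[Ys Yt] Yl]; split; [split|].
- by move=> c ca k; apply: (Ck_onD (open_cod (c:=c))); [exact: Xs|exact: Ys].
- move=> c d ca da x o; rewrite !fctE Xt// Yt// -deriveDdir//.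
  exact: transition_differentiable.
- move=> g c d ca da x o; rewrite !fctE Xl// Yl// -deriveDdir//.
  exact: ltranslation_differentiable.
Qed.

Lemma left_invariantZ k X : left_invariant X -> left_invariant (k *: X).
Proof.
move=> [[Xs Xt] Xl]; split; [split|].
- by move=> c ca j; apply: (Ck_onZ _ (open_cod (c:=c))); exact: Xs.
- move=> c d ca da x o; rewrite !fctE Xt// -deriveZdir//.
  exact: transition_differentiable.
- move=> g c d ca da x o; rewrite !fctE Xl// -deriveZdir//.
  exact: ltranslation_differentiable.
Qed.

(** A left translation moves any point to any other, across charts. *)
Lemma inner_left_invariant (a : tensor2 G) X Y c d x y :
  left_invariant_metric a -> left_invariant X -> left_invariant Y ->
  atlas c -> atlas d -> cod c x -> cod d y ->
  inner (a c x) (X c x) (Y c x) = inner (a d y) (X d y) (Y d y).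
Proof.
move=> [_ ainv] [_ Xl] [_ Yl] ca da cx dy.
pose g := (pt d y * (pt c x)^-1)%g.
have gx : (g * pt c x)%g = pt d y by rewrite /g -mulgA mulVg mulg1.
have T : ltranslation_dom g c d x by split=> //; rewrite gx; exact: pt_dom.
have Ty : ltranslation g c d x = y by rewrite /ltranslation gx ptK.
by rewrite (ainv g c d ca da x T) -Xl// -Yl// Ty.
Qed.

Lemma left_invariant_neq0 (a : tensor2 G) Y c x :
  left_invariant_metric a -> left_invariant Y -> ~ vf_eq Y 0 ->
  atlas c -> cod c x -> Y c x != 0.
Proof.
move=> ainv Yi Y0 ca cx; apply/eqP => Yx; apply: Y0 => d da y dy.
apply/eqP; apply: contraT => Yy.
have [[_ _ apos _] _] := ainv; have := apos d da y dy _ Yy.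
by rewrite (inner_left_invariant ainv Yi Yi da ca dy cx) Yx inner0l ltxx.
Qed.

End LeftInvariantFields.

(** The matrix with rows [e i] has a one-sided inverse, hence an inverse. *)
Lemma orthonormal_span {R : realType} {n : nat} (A : 'M[R]_n)
    (e : 'I_n -> 'rV[R]_n) :
  (forall i j, inner A (e i) (e j) = (i == j)%:R) ->
  forall w, exists s, w = \sum_i s i *: e i.
Proof.
move=> eA w; pose M := \matrix_i e i.
have MAM : M *m (A *m M^T) = 1%:M.
  apply/matrixP => i j; rewrite !mxE -eA /inner -mulmxA.
  rewrite !mxE; apply: eq_bigr => k _; rewrite mxE; congr (_ * _).
  by rewrite !mxE; apply: eq_bigr => l _; rewrite !mxE.
have Mu : M \in unitmx by case: (mulmx1_unit MAM).
exists (fun i => (w *m invmx M) 0 i).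
rewrite -[LHS](mulmxKV Mu) mulmx_sum_row; apply: eq_bigr => i _.
by rewrite rowK.
Qed.

(** The expression is linear in the test vector. *)
Lemma lagrange_form_sum {R : realType} {n m : nat} (A B : 'M[R]_n)
    (D : 'rV[R]_n -> 'M[R]_n) (v y : 'rV[R]_n) (e : 'I_m -> 'rV[R]_n) s :
  {morph D : u w / u + w} -> (forall k, {morph D : u / k *: u}) ->
  (forall i, inner A v (e i) + inner B y (e i)
             - 2^-1 * inner (D (e i)) y y = 0) ->
  inner A v (\sum_i s i *: e i) + inner B y (\sum_i s i *: e i)
    - 2^-1 * inner (D (\sum_i s i *: e i)) y y = 0.
Proof.
move=> DD DZ H.
pose phi u := inner A v u + inner B y u - 2^-1 * inner (D u) y y.
have phiD u w : phi (u + w) = phi u + phi w.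
  by rewrite /phi DD !innerE; ring.
have phiZ k u : phi (k *: u) = k * phi u by rewrite /phi DZ !innerE; ring.
have phi0 : phi 0 = 0 by rewrite -(scale0r 0) phiZ mul0r.
rewrite -/(phi _) (big_morph phi phiD phi0) big1// => i _.
by rewrite phiZ [phi _]H mulr0.
Qed.

Section RandersGeodesicVectors.
Context {R : realType} {n : nat} {G : lieGroup R n}.
Variables (metric : tensor2 G) (X Y : vfield G).
Hypotheses (metric_inv : left_invariant_metric metric).
Hypotheses (X_inv : left_invariant X) (Y_inv : left_invariant Y).
Hypothesis X_lt1 : forall k, atlas k -> forall x, cod k x ->
  Num.sqrt (inner (metric k x) (X k x) (X k x)) < 1.
Hypothesis F_douglas : douglas (randers metric X).
Implicit Types (c : chart R n G) (x y u v w : 'rV[R]_n).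

Definition dform_at c x : 'rV[R]_n -> 'rV[R]_n -> R :=
  dform (metric c) (X c) x (fun u => 'D_u (metric c) x)
    (fun u => 'D_u (X c) x).

Variable E : 'I_n -> vfield G.
Hypothesis E_inv : forall i, left_invariant (E i).
Hypothesis E_orth : forall c, atlas c -> forall x, cod c x -> forall i j,
  inner (metric c x) (E i c x) (E j c x) = (i == j)%:R.
Hypothesis Y_neq0 : ~ vf_eq Y 0.

Section AtPoint.
Variables (c : chart R n G) (x : 'rV[R]_n).
Hypotheses (ca : atlas c) (cx : cod c x).

Let Y_diff := vfield_differentiable Y_inv ca cx.
Let a_diff := metric_differentiable metric_inv ca cx.
Let X_diff := vfield_differentiable X_inv ca cx.
Let a_derive u := derivableP (diff_derivable (v := u) a_diff).
Let X_derive u := derivableP (diff_derivable (v := u) X_diff).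
Let Y_derive u := derivableP (diff_derivable (v := u) Y_diff).
Let dmD u v := deriveDdir u v a_diff.
Let dmZ k u := deriveZdir k u a_diff.
Let dfD u v := deriveDdir u v X_diff.
Let dfZ k u := deriveZdir k u X_diff.
Let oU := open_cod (c := c).
Let a_sym z : cod c z -> (metric c z)^T = metric c z.
Proof. by have [[_ + _ _] _] := metric_inv; apply. Qed.
Let a_pos : posdef (metric c x).
Proof. by have [[_ _ + _] _] := metric_inv; apply. Qed.
Let Xx := X_lt1 ca cx.

Lemma sprayE y :
  spray (randers metric X) c x y = coordinate_spray (metric c) (X c) x y.
Proof. by []. Qed.

(** In the difference of the sprays at [y] and [- y] the quadratic terms cancel,
    so it is a multiple of [y]. *)
Lemma douglas_closed y w : y != 0 -> dform_at c x y w = dform_at c x w y.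
Proof.
move=> y0; have [Gam [P [_ S]]] := F_douglas ca.
have Ny0 : - y != 0 by rewrite oppr_eq0.
apply: (closed_of_parallel (k := P x y + P x (- y)) oU cx a_derive X_derive
  dmD dmZ dfD dfZ a_sym a_pos Xx y0).
rewrite -!sprayE; apply/rowP => i.
have even : \sum_j \sum_k Gam i j k x * (- y) 0 j * (- y) 0 k =
    \sum_j \sum_k Gam i j k x * y 0 j * y 0 k.
  by apply: eq_bigr => j _; apply: eq_bigr => k _; rewrite !mxE; ring.
by rewrite [LHS]mxE [X in _ + X]mxE !S// even !mxE; ring.
Qed.

Lemma geodesic_at :
  'D_(Y c x) (Y c) x + 2 *: spray (randers metric X) c x (Y c x) = 0 <->
  forall i, inner (metric c x) (Y c x) (lie_bracket (E i) Y c x) = 0.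
Proof.
have E_diff i := vfield_differentiable (E_inv i) ca cx.
have y0 := left_invariant_neq0 metric_inv Y_inv Y_neq0 ca cx.
have cst Z W (Zi : left_invariant Z) (Wi : left_invariant W) z :
    cod c z -> inner (metric c z) (Z c z) (W c z) =
               inner (metric c x) (Z c x) (W c x).
  by move=> cz; exact: inner_left_invariant.
have YY : inner ('D_(Y c x) (metric c) x) (Y c x) (Y c x) +
    2 * inner (metric c x) (Y c x) ('D_(Y c x) (Y c) x) = 0.
  have := @derive_val _ _ _ _ _ _ _
    (is_derive_inner (a_derive (Y c x)) (Y_derive (Y c x)) (Y_derive (Y c x))).
  rewrite (derive_cst_on _ oU (cst _ _ Y_inv Y_inv) cx) => ->.
  by rewrite (innerC _ (Y c x) (a_sym cx)); ring.
have XY : dform_at c x (Y c x) (Y c x) +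
    inner (metric c x) (X c x) ('D_(Y c x) (Y c) x) = 0.
  have := @derive_val _ _ _ _ _ _ _
    (is_derive_inner (a_derive (Y c x)) (X_derive (Y c x)) (Y_derive (Y c x))).
  by rewrite (derive_cst_on _ oU (cst _ _ X_inv Y_inv) cx) => ->.
have closed w := douglas_closed w y0.
rewrite sprayE (geodesic_equationP oU cx a_derive X_derive dmD dmZ dfD dfZ
  a_sym a_pos Xx y0 closed YY XY).
have form i := frame_geodesic_form oU cx a_sym a_diff Y_diff (E_diff i)
  (cst _ _ Y_inv Y_inv) (cst _ _ Y_inv (E_inv i)).
split=> [H i|H w]; first by rewrite -[RHS](H (E i c x)) form.
have [s ->] := orthonormal_span (E_orth ca cx) w.
apply: (@lagrange_form_sum _ _ _ (metric c x) ('D_(Y c x) (metric c) x)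
    (fun u => 'D_u (metric c) x) ('D_(Y c x) (Y c) x) (Y c x)
    (fun i => E i c x) s dmD dmZ).
by move=> i; rewrite form; exact: H.
Qed.

End AtPoint.

(** The geodesic equation at time [0] is enough. *)
Lemma geodesic_vector_at : geodesic_vector (randers metric X) Y ->
  exists2 c, @atlas _ _ G c & exists2 x, cod c x &
    forall i, inner (metric c x) (Y c x) (lie_bracket (E i) Y c x) = 0.
Proof.
move=> [gam gexp [_ geod]]; have [c ca cg] := @atlas_cover R n G (gam 0).
exists c => //; exists (coord c (gam 0)); first exact: coord_cod.
apply/geodesic_at => //; first exact: coord_cod.
have [x' x''] := exp_curve_derive2 Y_inv gexp ca cg.
by have := geod c ca 0 cg; cbv zeta; rewrite x' x''.
Qed.

Lemma geodesic_vector_of_forms :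
  (forall c, atlas c -> forall x, cod c x -> forall i,
     inner (metric c x) (Y c x) (lie_bracket (E i) Y c x) = 0) ->
  geodesic_vector (randers metric X) Y.
Proof.
move=> H; have [gam gexp] := exp_curve_exists Y_inv; exists gam => //.
split; first by have [] := gexp.
move=> c ca t ct; cbv zeta.
have [x' ->] := exp_curve_derive2 Y_inv gexp ca ct; rewrite x'.
by apply/(geodesic_at ca (coord_cod ct)) => i; apply: H => //; exact: coord_cod.
Qed.

End RandersGeodesicVectors.

(** * The five dimensional nilpotent Lie algebra *)

Lemma inner_orthonormal_sum {R : realType} {n m : nat} (A : 'M[R]_n)
    (e : 'I_m -> 'rV[R]_n) (s : 'I_m -> R) j :
  (forall i j, inner A (e i) (e j) = (i == j)%:R) ->
  inner A (\sum_i s i *: e i) (e j) = s j.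
Proof.
move=> eA; rewrite (big_morph (fun u => inner A u (e j))
  (fun u v => innerDl A u v (e j)) (inner0l A (e j))).
rewrite (bigD1 j)//= innerZl eA eqxx mulr1 big1 ?addr0// => i ij.
by rewrite innerZl eA (negbTE ij) mulr0.
Qed.

Section LieBracket.
Context {R : realType} {n : nat} {G : lieGroup R n}.
Implicit Types (c : chart R n G) (X Y Z : vfield G).

Lemma lie_bracketC X Y c x : lie_bracket X Y c x = - lie_bracket Y X c x.
Proof. by rewrite /lie_bracket opprB. Qed.

Lemma lie_bracket_self X c x : lie_bracket X X c x = 0.
Proof. by rewrite /lie_bracket subrr. Qed.

Lemma lie_bracket_eqr Z X Y c x : atlas c -> cod c x -> vf_eq X Y ->
  lie_bracket Z X c x = lie_bracket Z Y c x.
Proof.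
move=> ca cx XY; rewrite /lie_bracket (XY c ca x cx); congr (_ - _).
by apply: (derive_eq_on _ (open_cod (c:=c)) _ cx) => z; exact: XY.
Qed.

Lemma lie_bracketDr Z X Y c x : atlas c -> cod c x ->
  left_invariant X -> left_invariant Y -> left_invariant Z ->
  lie_bracket Z (X + Y) c x = lie_bracket Z X c x + lie_bracket Z Y c x.
Proof.
move=> ca cx Xi Yi Zi; rewrite /lie_bracket.
have Zd := vfield_differentiable Zi ca cx.
have D U (Ui : left_invariant U) : derivable (U c) x (Z c x).
  by apply: diff_derivable; exact: vfield_differentiable.
have := deriveD (D _ Xi) (D _ Yi); rewrite -[(X + Y) c]/(X c + Y c) => ->.
rewrite -[(X c + Y c) x]/(X c x + Y c x) deriveDdir//.
by rewrite opprD addrACA.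
Qed.

Lemma lie_bracketZr Z k X c x : atlas c -> cod c x ->
  left_invariant X -> left_invariant Z ->
  lie_bracket Z (k *: X) c x = k *: lie_bracket Z X c x.
Proof.
move=> ca cx Xi Zi; rewrite /lie_bracket.
have Zd := vfield_differentiable Zi ca cx.
have Xd : derivable (X c) x (Z c x).
  by apply: diff_derivable; exact: vfield_differentiable.
have := deriveZ k Xd; rewrite -[(k *: X) c]/(k *: X c) => ->.
by rewrite -[(k *: X c) x]/(k *: X c x) deriveZdir// scalerBr.
Qed.

End LieBracket.

(** The fourth equation gives [y1 = 0] or [y5 = 0].  If [y1] is nonzero, the
    third and second equations give [y4 = 0] and [y3 = 0] in turn.  If [y1 = 0]
    and [y5] is nonzero, they give [y3 = y2 = 0], and then the first gives
    [y4 = 0].  If both vanish, only the first equation is left. *)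
Lemma l56_geodesic_equations {R : realFieldType} (a b c d f g h : R)
    (y1 y2 y3 y4 y5 : R) :
  0 < a -> 0 < d -> 0 < g -> 0 < h ->
  [/\ y2 * (a * y3 + b * y4 + c * y5) + y3 * (d * y4 + f * y5)
        + y4 * (g * y5) = 0,
      - y1 * (a * y3 + b * y4 + c * y5) + y3 * (h * y5) = 0,
      - y1 * (d * y4 + f * y5) - y2 * (h * y5) = 0 &
      - y1 * (g * y5) = 0] <->
  [\/ [/\ y3 = 0, y4 = 0 & y5 = 0],
      [/\ y1 = 0, y5 = 0 & a * y2 * y3 + b * y2 * y4 + d * y3 * y4 = 0] |
      [/\ y1 = 0, y2 = 0, y3 = 0 & y4 = 0]].
Proof.
move=> a0 d0 g0 h0; split; last first.
  case=> [[-> -> ->]|[-> -> e]|[-> -> -> ->]]; split; try ring.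
  by rewrite -[RHS]e; ring.
move=> [e1 e2 e3 e4].
have [y10|y10] := eqVneq y1 0; last first.
  have y50 : y5 = 0.
    move/eqP: e4; rewrite !mulf_eq0 oppr_eq0 (negbTE y10) (gt_eqF g0) /=.
    by move/eqP.
  have y40 : y4 = 0.
    move/eqP: e3; rewrite y50 !mulr0 addr0 subr0 !mulf_eq0 oppr_eq0.
    by rewrite (negbTE y10) (gt_eqF d0) /= => /eqP.
  apply: Or31; split=> //.
  move/eqP: e2; rewrite y50 y40 !mulr0 !addr0 !mulf_eq0 oppr_eq0.
  by rewrite (negbTE y10) (gt_eqF a0) /= => /eqP.
have [y50|y50] := eqVneq y5 0.
  apply: Or32; split=> //.
  by rewrite -[RHS]e1 y50; ring.
have y30 : y3 = 0.
  move/eqP: e2; rewrite y10 oppr0 mul0r add0r !mulf_eq0 (negbTE y50).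
  by rewrite (gt_eqF h0) !orbF => /eqP.
have y20 : y2 = 0.
  move/eqP: e3; rewrite y10 oppr0 mul0r add0r oppr_eq0 !mulf_eq0 (negbTE y50).
  by rewrite (gt_eqF h0) !orbF => /eqP.
apply: Or33; split=> //.
move/eqP: e1; rewrite y30 y20 !mul0r !add0r !mulf_eq0 (negbTE y50).
by rewrite (gt_eqF g0) !orbF => /eqP.
Qed.

Lemma forall_I5 (P : nat -> Prop) : (forall i : 'I_5, P i) <->
  [/\ P 0%N, P 1%N, P 2%N, P 3%N & P 4%N].
Proof.
split=> [H|[? ? ? ? ?] [[|[|[|[|[|//]]]]] i5]//].
split; [exact: (H (@Ordinal 5 0 isT))|exact: (H (@Ordinal 5 1 isT))
  |exact: (H (@Ordinal 5 2 isT))|exact: (H (@Ordinal 5 3 isT))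
  |exact: (H (@Ordinal 5 4 isT))].
Qed.

Section OrthonormalFrame.
Context {R : realType} {G : lieGroup R 5}.
Variables (metric : tensor2 G) (E1 E2 E3 E4 E5 : vfield G).
Hypothesis E_basis : orthonormal_basis metric [tuple E1; E2; E3; E4; E5].
Variables (y1 y2 y3 y4 y5 : R) (Y : vfield G).
Hypothesis Y_def :
  vf_eq Y (y1 *: E1 + y2 *: E2 + y3 *: E3 + y4 *: E4 + y5 *: E5).
Implicit Types (k : chart R 5 G) (x : 'rV[R]_5).

Definition frame (i : nat) : vfield G := nth E1 [:: E1; E2; E3; E4; E5] i.

Definition coords (i : nat) : R := nth 0 [:: y1; y2; y3; y4; y5] i.

Lemma tnth_frame (i : 'I_5) : tnth [tuple E1; E2; E3; E4; E5] i = frame i.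
Proof. exact: (tnth_nth E1). Qed.

Lemma frame_invariant (i : 'I_5) : left_invariant (frame i).
Proof. by have [/(_ i) + _ _] := E_basis; rewrite tnth_frame. Qed.

Lemma frame_orthonormal k : atlas k -> forall x, cod k x -> forall i j : 'I_5,
  inner (metric k x) (frame i k x) (frame j k x) = (i == j)%:R.
Proof.
move=> ka x kx i j; have [_ _ /(_ k ka x kx i j)] := E_basis.
by rewrite !tnth_frame.
Qed.

Lemma inner_frame k x (j : 'I_5) : atlas k -> cod k x ->
  inner (metric k x) (Y k x) (frame j k x) = coords j.
Proof.
move=> ka kx.
rewrite -[RHS](inner_orthonormal_sum coords _ (frame_orthonormal ka kx)).
by rewrite Y_def// !big_ord_recr big_ord0 /= add0r.
Qed.

(** Coordinates in an orthonormal frame are unique; evaluating at the identity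
    suffices, as the coefficients are constant. *)
Lemma vf_eq_frame_sum (t : nat -> R) :
  vf_eq Y (\sum_(i < 5) t i *: frame i) <-> forall i : 'I_5, t i = coords i.
Proof.
split=> [Yt i|ty k ka x kx].
  have [k ka k1] := @atlas_cover R 5 G 1%g; have kx := coord_cod k1.
  rewrite -(inner_frame i ka kx) Yt// 2!fct_sumE.
  by rewrite (inner_orthonormal_sum t _ (frame_orthonormal ka kx)).
rewrite Y_def// 2!fct_sumE.
under eq_bigr => i _ do rewrite !fctE ty.
by rewrite !big_ord_recr big_ord0 /= add0r.
Qed.

Lemma vf_span12 : vf_span [:: E1; E2] Y <-> [/\ y3 = 0, y4 = 0 & y5 = 0].
Proof.
(* Missing coefficients are read as the default value [0]. *)
have sumE (t : nat -> R) : \sum_(i < 2) t i *: [:: E1; E2]`_i =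
    \sum_(i < 5) [:: t 0%N; t 1%N]`_i *: frame i.
  by rewrite !big_ord_recr !big_ord0 /= !(scale0r, addr0).
split=> [[t]|[z3 z4 z5]].
  rewrite /= sumE => /(vf_eq_frame_sum (nth 0 _)).
  by move=> /(forall_I5 (fun i => _ i = _ i))[].
exists coords; rewrite /= sumE; apply/(vf_eq_frame_sum (nth 0 _)).
by apply/(forall_I5 (fun i => _ i = _ i)).
Qed.

Lemma vf_span234 : vf_span [:: E2; E3; E4] Y <-> y1 = 0 /\ y5 = 0.
Proof.
have sumE (t : nat -> R) : \sum_(i < 3) t i *: [:: E2; E3; E4]`_i =
    \sum_(i < 5) [:: 0; t 0%N; t 1%N; t 2%N]`_i *: frame i.
  by rewrite !big_ord_recr !big_ord0 /= !(scale0r, addr0).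
split=> [[t]|[z1 z5]].
  rewrite /= sumE => /(vf_eq_frame_sum (nth 0 _)).
  by move=> /(forall_I5 (fun i => _ i = _ i))[].
exists (fun i => coords i.+1); rewrite /= sumE.
by apply/(vf_eq_frame_sum (nth 0 _))/(forall_I5 (fun i => _ i = _ i)).
Qed.

Lemma vf_span5 : vf_span [:: E5] Y <-> [/\ y1 = 0, y2 = 0, y3 = 0 & y4 = 0].
Proof.
have sumE (t : nat -> R) : \sum_(i < 1) t i *: [:: E5]`_i =
    \sum_(i < 5) [:: 0; 0; 0; 0; t 0%N]`_i *: frame i.
  by rewrite !big_ord_recr !big_ord0 /= !(scale0r, addr0).
split=> [[t]|[z1 z2 z3 z4]].
  rewrite /= sumE => /(vf_eq_frame_sum (nth 0 _)).
  by move=> /(forall_I5 (fun i => _ i = _ i))[].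
exists (fun=> y5); rewrite /= sumE; apply/(vf_eq_frame_sum (nth 0 _)).
by apply/(forall_I5 (fun i => _ i = _ i)).
Qed.

Let I1 : left_invariant E1 := frame_invariant (@Ordinal 5 0 isT).
Let I2 : left_invariant E2 := frame_invariant (@Ordinal 5 1 isT).
Let I3 : left_invariant E3 := frame_invariant (@Ordinal 5 2 isT).
Let I4 : left_invariant E4 := frame_invariant (@Ordinal 5 3 isT).
Let I5 : left_invariant E5 := frame_invariant (@Ordinal 5 4 isT).
Let J1 := left_invariantZ y1 I1.
Let J2 := left_invariantZ y2 I2.
Let J3 := left_invariantZ y3 I3.
Let J4 := left_invariantZ y4 I4.
Let J5 := left_invariantZ y5 I5.
Let J12 := left_invariantD J1 J2.
Let J123 := left_invariantD J12 J3.
Let J1234 := left_invariantD J123 J4.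

Lemma combination_invariant : left_invariant Y.
Proof. exact: left_invariant_eq Y_def (left_invariantD J1234 J5). Qed.

Lemma lie_bracket_combination Z k x :
  left_invariant Z -> atlas k -> cod k x ->
  lie_bracket Z Y k x =
  y1 *: lie_bracket Z E1 k x + y2 *: lie_bracket Z E2 k x +
  y3 *: lie_bracket Z E3 k x + y4 *: lie_bracket Z E4 k x +
  y5 *: lie_bracket Z E5 k x.
Proof.
move=> Zi ka kx; rewrite (lie_bracket_eqr Z ka kx Y_def).
rewrite (lie_bracketDr ka kx J1234 J5 Zi) (lie_bracketDr ka kx J123 J4 Zi).
rewrite (lie_bracketDr ka kx J12 J3 Zi) (lie_bracketDr ka kx J1 J2 Zi).
by rewrite (lie_bracketZr _ ka kx I1 Zi) (lie_bracketZr _ ka kx I2 Zi)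
  (lie_bracketZr _ ka kx I3 Zi) (lie_bracketZr _ ka kx I4 Zi)
  (lie_bracketZr _ ka kx I5 Zi).
Qed.

Variables a b c d f g h : R.
Hypothesis E_brackets : l56_brackets E1 E2 E3 E4 E5 a b c d f g h.

(** The value of [<Y, [E_i, Y]>] for the [i]-th field of the frame, [i] counted
    from [0]. *)
Definition l56_form (i : nat) : R := nth 0 [::
  y2 * (a * y3 + b * y4 + c * y5) + y3 * (d * y4 + f * y5) + y4 * (g * y5);
  - y1 * (a * y3 + b * y4 + c * y5) + y3 * (h * y5);
  - y1 * (d * y4 + f * y5) - y2 * (h * y5);
  - y1 * (g * y5); 0] i.

Lemma inner_lie_bracket k x (i : 'I_5) : atlas k -> cod k x ->
  inner (metric k x) (Y k x) (lie_bracket (frame i) Y k x) = l56_form i.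
Proof.
move=> ka kx.
have -> : lie_bracket (frame i) Y k x = _ :=
  lie_bracket_combination (frame_invariant i) ka kx.
have [b12 [b13 [b14 [b15 [b23 [b24 [b25 [b34 [b35 b45]]]]]]]]] := E_brackets.
have B12 : lie_bracket E1 E2 k x = a *: E3 k x + b *: E4 k x + c *: E5 k x
  := b12 k ka x kx.
have B13 : lie_bracket E1 E3 k x = d *: E4 k x + f *: E5 k x := b13 k ka x kx.
have B14 : lie_bracket E1 E4 k x = g *: E5 k x := b14 k ka x kx.
have B15 : lie_bracket E1 E5 k x = 0 := b15 k ka x kx.
have B23 : lie_bracket E2 E3 k x = h *: E5 k x := b23 k ka x kx.
have B24 : lie_bracket E2 E4 k x = 0 := b24 k ka x kx.
have B25 : lie_bracket E2 E5 k x = 0 := b25 k ka x kx.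
have B34 : lie_bracket E3 E4 k x = 0 := b34 k ka x kx.
have B35 : lie_bracket E3 E5 k x = 0 := b35 k ka x kx.
have B45 : lie_bracket E4 E5 k x = 0 := b45 k ka x kx.
have BE := (B12, B13, B14, B15, B23, B24, B25, B34, B35, B45).
have Y1 : inner (metric k x) (Y k x) (E1 k x) = y1
  := inner_frame (@Ordinal 5 0 isT) ka kx.
have Y2 : inner (metric k x) (Y k x) (E2 k x) = y2
  := inner_frame (@Ordinal 5 1 isT) ka kx.
have Y3 : inner (metric k x) (Y k x) (E3 k x) = y3
  := inner_frame (@Ordinal 5 2 isT) ka kx.
have Y4 : inner (metric k x) (Y k x) (E4 k x) = y4
  := inner_frame (@Ordinal 5 3 isT) ka kx.
have Y5 : inner (metric k x) (Y k x) (E5 k x) = y5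
  := inner_frame (@Ordinal 5 4 isT) ka kx.
have YEx := (Y1, Y2, Y3, Y4, Y5).
case: i => -[|[|[|[|[|//]]]]] i5; rewrite /l56_form /frame /= lie_bracket_self.
- by rewrite !BE !innerE !YEx; ring.
- by rewrite (lie_bracketC E2 E1) !BE !innerE !YEx; ring.
- by rewrite (lie_bracketC E3 E1) (lie_bracketC E3 E2) !BE !innerE !YEx; ring.
- rewrite (lie_bracketC E4 E1) (lie_bracketC E4 E2) (lie_bracketC E4 E3).
  by rewrite !BE !innerE !YEx; ring.
- rewrite (lie_bracketC E5 E1) (lie_bracketC E5 E2) (lie_bracketC E5 E3).
  by rewrite (lie_bracketC E5 E4) !BE !innerE; ring.
Qed.

End OrthonormalFrame.

Theorem theorem3p7 (R : realType) (G : lieGroup R 5)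
  (G_simply_connected : simply_connected R G)
  (G_nilpotent : nilpotent_group G)
  (metric : tensor2 G) (metric_inv : left_invariant_metric metric)
  (E1 E2 E3 E4 E5 : vfield G)
  (E_basis : orthonormal_basis metric [tuple E1; E2; E3; E4; E5])
  (a b c d f g h : R)
  (E_brackets : l56_brackets E1 E2 E3 E4 E5 a b c d f g h)
  (a_gt0 : 0 < a) (d_gt0 : 0 < d) (g_gt0 : 0 < g) (h_gt0 : 0 < h)
  (bf_cond : 0 < b \/ (b = 0 /\ 0 <= f))
  (X : vfield G) (X_inv : left_invariant X)
  (X_lt1 : forall k, atlas k -> forall x, cod k x ->
     Num.sqrt (inner (metric k x) (X k x) (X k x)) < 1)
  (F_douglas : douglas (randers metric X))
  (y1 y2 y3 y4 y5 : R) (Y : vfield G)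
  (Y_def : vf_eq Y (y1 *: E1 + y2 *: E2 + y3 *: E3 + y4 *: E4 + y5 *: E5))
  (Y_neq0 : ~ vf_eq Y 0) :
  geodesic_vector (randers metric X) Y <->
  (vf_span [:: E1; E2] Y \/
   (vf_span [:: E2; E3; E4] Y /\
    a * y2 * y3 + b * y2 * y4 + d * y3 * y4 = 0) \/
   vf_span [:: E5] Y).
Proof.
have e_inv := frame_invariant E_basis.
have e_orth := frame_orthonormal E_basis.
have Y_inv := combination_invariant E_basis Y_def.
have form k x i := @inner_lie_bracket _ _ _ _ _ _ _ _ E_basis _ _ _ _ _ _ Y_def
  _ _ _ _ _ _ _ E_brackets k x i.
have gY : geodesic_vector (randers metric X) Y <->
    forall i : 'I_5, l56_form y1 y2 y3 y4 y5 a b c d f g h i = 0.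
  split=> [|q0].
    move=> /(geodesic_vector_at metric_inv X_inv Y_inv X_lt1 F_douglas
      e_inv e_orth Y_neq0).
    by move=> [k ka [x kx H]] i; rewrite -(form k x i ka kx).
  apply: (geodesic_vector_of_forms metric_inv X_inv Y_inv X_lt1 F_douglas
      e_inv e_orth Y_neq0).
  by move=> k ka x kx i; rewrite form.
rewrite gY (forall_I5 (fun i => l56_form _ _ _ _ _ _ _ _ _ _ _ _ i = 0)).
rewrite (vf_span12 E_basis Y_def) (vf_span234 E_basis Y_def).
rewrite (vf_span5 E_basis Y_def).
have := l56_geodesic_equations b c f y1 y2 y3 y4 y5 a_gt0 d_gt0 g_gt0 h_gt0.
rewrite /l56_form /= => H; split=> [[q0 q1 q2 q3 _]|K].
  have [|r|[? ? ?]|r] := H.1 _; first by split.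
  - by left.
  - by right; left.
  - by right; right.
have [] := H.2 _; last by split.
case: K => [r|[[[? ?] ?]|r]]; [exact: Or31|exact: Or32|exact: Or33].
Qed.
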